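(* Let $(X,d)$ be a compact metric space, $f:X\to X$ continuous and $\varphi\in C(X)$. Let $Z\subset X$ be an arbitrary Borel set (not assumed invariant) and let $Y=\overline{\bigcup_{k\in\mathbb N} f^{-k}Z}$. Then $$P_Z(\varphi)\le P^{\ast}_Z(\varphi)\le P^{\mathrm{classic}}_Y(\varphi).$$
   Context: $C(X)$ is the space of continuous real-valued functions on $X$, $\mathcal M_f(X)$ is the set of $f$-invariant Borel probability measures on $X$, and $h_\mu$ is the measure-theoretic (Kolmogorov–Sinai) entropy of $f$ with respect to $\mu$. The set $f^{-k}Z$ is the preimage of $Z$ under $f^k$, and the bar denotes closure in $X$. For $x\in X$, $n\ge1$, put $\delta_{x,n}=\frac1n\sum_{k=0}^{n-1}\delta_{f^k(x)}$ (where $\delta_x$ is the Dirac measure at $x$) and $\mathcal V(x)=\{\mu\in\mathcal M_f(X):\delta_{x,n_k}\to\mu \text{ (weak-* ) for some } n_k\to\infty\}$. For non-empty Borel $Z$, $P^\ast_Z(\varphi)=\sup\{h_\mu+\int_X\varphi\,d\mu:\mu\in\mathcal V(x)\text{ for some }x\in Z\}$; by convention $P^\ast_\emptyset(\varphi)=\inf_{x\in X}\varphi(x)$. $P^{\mathrm{classic}}_K(\varphi)$ denotes the usual (Walters) topological pressure of $\varphi$ on a compact invariant set $K$. Pesin–Pitskel pressure $P_Z(\varphi)$: for a finite open cover $\mathcal U$ of $X$, a string of length $m=m(\mathbf U)$ is $\mathbf U=(U_{i_0},\dots,U_{i_{m-1}})$ with $U_{i_j}\in\mathcal U$, and $\mathbf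 X(\mathbf U)=\{x\in X: f^j(x)\in U_{i_j},\ 0\le j\le m-1\}$. A collection $\mathcal G$ of strings covers $Z$ if $Z\subset\bigcup_{\mathbf U\in\mathcal G}\mathbf X(\mathbf U)$. For $\alpha\in\mathbb R$ let $$M(Z,\alpha,\mathcal U,N,\varphi)=\inf_{\mathcal G}\sum_{\mathbf U\in\mathcal G}\exp\Big(-\alpha m(\mathbf U)+\sup_{x\in\mathbf X(\mathbf U)}\sum_{k=0}^{m(\mathbf U)-1}\varphi(f^k x)\Big),$$ the infimum over finite or countable collections $\mathcal G$ of strings covering $Z$ with $m(\mathbf U)\ge N$ for all $\mathbf U\in\mathcal G$ (the supremum is $-\infty$ if $\mathbf X(\mathbf U)=\emptyset$). Let $m(Z,\alpha,\mathcal U,\varphi)=\lim_{N\to\infty}M(Z,\alpha,\mathcal U,N,\varphi)$, $P_Z(\varphi,\mathcal U)=\inf\{\alpha:m(Z,\alpha,\mathcal U,\varphi)=0\}$ and $P_Z(\varphi)=\lim_{|\mathcal U|\to0}P_Z(\varphi,\mathcal U)$, where $|\mathcal U|$ is the maximal diameter of the elements of $\mathcal U$ (the limit exists).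
   Formalization: The second inequality is stated only when f(Y) ⊆ Y, since the classic pressure is defined only on compact invariant sets and Y need not be invariant; for empty Z (so empty Y) the undefined classic pressure is set to inf φ, as for P*. *)

(* Defs.v *)
From HB Require Import structures.
From mathcomp Require Import all_boot all_order all_algebra.
From mathcomp Require Import all_classical all_reals all_analysis.

Set Implicit Arguments.
Unset Strict Implicit.
Unset Printing Implicit Defensive.

Import Order.TTheory GRing.Theory Num.Theory.
Import numFieldNormedType.Exports.

Local Open Scope classical_set_scope.
Local Open Scope ring_scope.

(* Nonempty metric spaces: the library puts a generated sigma-algebra only on
   pointed types.  The base point is never used. *)
#[short(type="pointedMetricType")]
HB.structure Definition PointedMetric (K : numDomainType) :=
  {M of Metric K M & Pointed M}.

Definition borel {R : realType} (X : pointedMetricType R) :=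
  g_sigma_algebraType (@open X).

Section Dynamics.
Context {R : realType} {X : pointedMetricType R}.
Implicit Types (f : X -> X) (phi : X -> R) (Z K : set X) (x : X).

Definition birkhoff_sum f phi (n : nat) x : R := \sum_(k < n) phi (iter k f x).

Definition inf_potential phi : \bar R := ereal_inf [set (phi x)%:E | x in setT].

Definition forward_invariant f K := f @` K `<=` K.

Definition invariant_measure f (mu : probability (borel X) R) :=
  forall A : set (borel X), measurable A -> mu (f @^-1` A) = mu A.

(* Finite measurable partitions, listed with possibly empty cells. *)
Definition finite_partition (m : nat) (A : 'I_m -> set (borel X)) :=
  [/\ forall i, measurable (A i), trivIset setT A & \bigcup_i A i = setT].

(* The cell of the join of A, f^-1 A, ..., f^-(n-1) A with itinerary w. *)
Definition join_cell f (m n : nat) (A : 'I_m -> set (borel X))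
    (w : {ffun 'I_n -> 'I_m}) : set (borel X) :=
  \bigcap_(k in [set: 'I_n]) (iter k f @^-1` A (w k)).

(* Here 0 * ln 0 = 0. *)
Definition join_entropy f (mu : probability (borel X) R) (m : nat)
    (A : 'I_m -> set (borel X)) (n : nat) : R :=
  - \sum_(w : {ffun 'I_n -> 'I_m})
      fine (mu (join_cell f A w)) * ln (fine (mu (join_cell f A w))).

Definition entropy_wrt f (mu : probability (borel X) R) (m : nat)
    (A : 'I_m -> set (borel X)) : R :=
  limn (fun n => join_entropy f mu A n / n%:R).

Definition measure_entropy f (mu : probability (borel X) R) : \bar R :=
  ereal_sup [set h | exists m (A : 'I_m -> set (borel X)),
    finite_partition A /\ h = (entropy_wrt f mu A)%:E].

Definition empirical_measure f x (n : nat) : set (borel X) -> \bar R :=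
  mscale (n%:R^-1%:nng : {nonneg R})
         (msum (fun k => dirac (iter k f x : borel X)) n).

(* Weak-* convergence, tested on continuous functions; X is compact. *)
Definition weak_star_cvg (nu : nat -> set (borel X) -> \bar R)
    (mu : set (borel X) -> \bar R) :=
  forall psi : X -> R, continuous psi ->
    (\int[nu k]_(x in [set: borel X]) (psi x)%:E)%E @[k --> \oo] -->
    (\int[mu]_(x in [set: borel X]) (psi x)%:E)%E.

Definition limit_measures f x : set (probability (borel X) R) :=
  [set mu | invariant_measure f mu /\
    exists n_ : nat -> nat, n_ @ \oo --> \oo /\
      weak_star_cvg (fun k => empirical_measure f x (n_ k)) mu].

Definition free_energy f phi (mu : probability (borel X) R) : \bar R :=
  (measure_entropy f mu + \int[mu]_(x in [set: borel X]) (phi x)%:E)%E.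

Definition star_pressure f phi Z : \bar R :=
  if Z == set0 then inf_potential phi
  else ereal_sup [set free_energy f phi mu |
                    mu in \bigcup_(x in Z) limit_measures f x].

Definition finite_open_cover (U : seq (set X)) :=
  (forall A, A \in U -> open A) /\ \bigcup_(A in [set` U]) A = setT.

Definition diameter (A : set X) : \bar R :=
  ereal_sup [set (mdist p.1 p.2)%:E | p in A `*` A].

Definition mesh (U : seq (set X)) : \bar R :=
  ereal_sup [set diameter A | A in [set` U]].

(* The filter of finite open covers U with |U| -> 0. *)
Definition mesh_to_0 : set_system (seq (set X)) :=
  filter_from [set e : R | 0 < e]
    (fun e => [set U | finite_open_cover U /\ (mesh U < e%:E)%E]).

Definition string_set f (s : seq (set X)) : set X :=
  [set x | forall j, (j < size s)%N -> nth set0 s j (iter j f x)].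

(* When the string set is empty the supremum is -oo and the weight is 0. *)
Definition string_weight f phi (alpha : R) (s : seq (set X)) : \bar R :=
  expeR ((- alpha * (size s)%:R)%:E +
         ereal_sup [set (birkhoff_sum f phi (size s) x)%:E
                   | x in string_set f s])%E.

Definition covering_strings f Z (U : seq (set X)) (N : nat)
    (G : set (seq (set X))) :=
  [/\ countable G,
      forall s, G s -> (N <= size s)%N /\ {subset s <= U} &
      Z `<=` \bigcup_(s in G) string_set f s].

Definition pp_outer f phi Z (alpha : R) (U : seq (set X)) (N : nat) : \bar R :=
  ereal_inf [set \esum_(s in G) string_weight f phi alpha s
            | G in covering_strings f Z U N].

Definition pp_limit f phi Z (alpha : R) (U : seq (set X)) : \bar R :=
  limn (pp_outer f phi Z alpha U).

Definition pp_pressure_cover f phi Z (U : seq (set X)) : \bar R :=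
  ereal_inf [set alpha%:E | alpha in [set a : R | pp_limit f phi Z a U = 0%E]].

Definition pp_pressure f phi Z : \bar R :=
  lim (pp_pressure_cover f phi Z @ mesh_to_0).

Definition spanning f K (n : nat) (e : R) (F : set X) :=
  [/\ finite_set F, F `<=` K &
      forall x, K x -> exists2 y, F y &
        forall i, (i < n)%N -> mdist (iter i f x) (iter i f y) <= e].

Definition spanning_sum f phi K (n : nat) (e : R) : \bar R :=
  ereal_inf [set (\sum_(y \in F) expR (birkhoff_sum f phi n y))%:E
            | F in spanning f K n e].

(* The pressure of the restriction of f to K, so it has this meaning for K
   compact and forward invariant.  Walters takes K nonempty; on the empty set
   the convention is the one used for star_pressure. *)
Definition classic_pressure f phi K : \bar R :=
  if K == set0 then inf_potential phi
  else lim ((limn_esup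
               (fun n => (n%:R^-1)%:E * lne (spanning_sum f phi K n e))%E)
            @[e --> 0^'+]).

End Dynamics.

(* Main.v *)
Require Import Defs.
From HB Require Import structures.
From mathcomp Require Import all_boot all_order all_algebra.
From mathcomp Require Import all_classical all_reals all_analysis.
From mathcomp Require Import measurable_realfun metric_structure urysohn ring lra.

(** Both inequalities come from one reading of entropy: by Gibbs' inequality
    ([gibbs]) the entropy H_n of the words of length n is at most the mean length
    of any code for these words that satisfies Kraft's inequality.  Good codes for
    the itineraries of mu-typical points give the upper bound of the variational
    principle; conversely, an almost optimal code is turned into a cover of Z by
    strings whose Gibbs weights have a small sum.

    Star pressure and classical pressure.  A limit mu of averages along the orbit
    of a point of Z is carried by Y, as the orbit stays in the closed set Y
    ([limit_measure_support]).  Given a partition, choose disjoint closed sets in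
    its cells that carry almost all the mass of mu; they are a positive distance
    apart.  If e is small, a point y of an (n, e)-spanning set F determines the
    symbols of each orbit that it shadows, except at the rare times spent outside
    the closed sets.  So an itinerary can be coded by naming y and correcting a
    small proportion of symbols.  If y is given the probability
    exp (S_n phi y) / sum_F exp (S_n phi), the mean length of this code shows that
    H_n + n int phi dmu <= ln (sum_F exp (S_n phi)) + n eps
    ([join_entropy_le_spanning]); then n tends to infinity and e to 0
    ([entropy_wrt_le_classic]).

    Pesin-Pitskel pressure and star pressure.  Let c be the star pressure, assumed
    finite, let U be a cover and x a point of Z.  The averages along the orbit of
    x have a limit measure mu ([limit_measures_nonempty]); as its free energy is at
    most c, there is a block length m with H_m / m + int phi dmu <= c + eps, for a
    partition subordinate to U, and a code for the words of length m with mean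
    length close to H_m.  The length of the cheapest word over U that is available
    at a point is an upper semicontinuous function of the point, being a minimum
    over open sets; so its averages along the orbit of x are asymptotically at most
    its mean with respect to mu ([cheapest_word_average]).  Cutting the orbit into
    cheapest words from the best of the m phases, one obtains arbitrarily long
    strings that contain x and on which S_N phi plus the code length is at most
    N (c + 6 eps) ([coded_of_limit_measure]).  By Kraft's inequality the weights
    of all such strings, for an exponent alpha above c + 6 eps by more than the
    oscillation of phi on the elements of U, have arbitrarily small sums
    ([pp_limit_coded]).  As the code can be taken rational, countably many pairs of
    a block length and a code serve all points of Z ([pp_pressure_le]).  The limit
    over covers exists because refining a cover lowers the pressure by at most the
    oscillation of phi on the coarser one ([pp_pressure_cover_refine]).

    Limit measures exist by compactness: the limit of the averages along an
    ultrafilter is a finitely additive probability on all sets, whose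
    regularization is a Borel measure ([content_extension]) with the same mean of
    each continuous function ([mean_of_open_domination]). *)

Set Implicit Arguments.
Unset Strict Implicit.
Unset Printing Implicit Defensive.

Import Order.TTheory GRing.Theory Num.Theory.
Import numFieldNormedType.Exports.

Local Open Scope classical_set_scope.
Local Open Scope ring_scope.

(** * Means of bounded measurable functions *)

Section Means.
Context {R : realType} {d : measure_display} {T : measurableType d}.
Implicit Types (mu : probability T R) (g h : T -> R).

Definition bounded_measurable g :=
  measurable_fun setT g /\ exists M : R, forall x, `|g x| <= M.

Definition mean mu g : R := \int[mu]_x g x.

Lemma bounded_measurable_cst (c : R) : bounded_measurable (cst c).
Proof. by split=> //; exists `|c|. Qed.

Lemma bounded_measurableD g h : bounded_measurable g -> bounded_measurable h ->
  bounded_measurable (fun x => g x + h x).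
Proof.
move=> [mg [M gM]] [mh [N hN]]; split; first exact: measurable_funD.
by exists (M + N) => x; rewrite (le_trans (ler_normD _ _))// lerD.
Qed.

Lemma bounded_measurableM g h : bounded_measurable g -> bounded_measurable h ->
  bounded_measurable (fun x => g x * h x).
Proof.
move=> [mg [M gM]] [mh [N hN]]; split; first exact: measurable_funM.
by exists (M * N) => x; rewrite normrM ler_pM.
Qed.

Lemma bounded_measurableZ (c : R) g : bounded_measurable g ->
  bounded_measurable (fun x => c * g x).
Proof. exact/bounded_measurableM/bounded_measurable_cst. Qed.

Lemma bounded_measurable_sum (I : Type) (s : seq I) (h : I -> T -> R) :
  (forall i, bounded_measurable (h i)) ->
  bounded_measurable (fun x => \sum_(i <- s) h i x).
Proof.
move=> bh; elim: s => [|i s IH].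
  by under eq_fun do rewrite big_nil; exact: bounded_measurable_cst.
by under eq_fun do rewrite big_cons; exact: bounded_measurableD.
Qed.

Lemma bounded_measurable_indic (A : set T) : measurable A ->
  bounded_measurable (\1_A : T -> R).
Proof.
move=> mA; split; first exact: measurable_indic.
exists 1 => x; rewrite indicE; case: (x \in A) => /=; first by rewrite normr1.
by rewrite normr0.
Qed.

Lemma bounded_measurable_comp g (u : T -> T) : measurable_fun setT u ->
  bounded_measurable g -> bounded_measurable (fun x => g (u x)).
Proof.
move=> mu [mg [M gM]]; split; first exact: (measurableT_comp mg mu).
by exists M.
Qed.

Lemma bounded_measurable_integrable mu g (A : set T) : measurable A ->
  bounded_measurable g -> mu.-integrable A (EFin \o g).
Proof.
move=> mA [mg [M gM]]; apply: measurable_bounded_integrable => //.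
- by rewrite (le_lt_trans (probability_le1 mu mA))// ltry.
- exact: measurable_funTS.
- exists M; split; first exact: num_real.
  by move=> N MN x _ /=; exact: le_trans (gM x) (ltW MN).
Qed.

Lemma mean_EFin mu g : bounded_measurable g ->
  (\int[mu]_x (g x)%:E)%E = (mean mu g)%:E.
Proof.
move=> bg; rewrite /mean /Rintegral fineK//.
exact/integrable_fin_num/bounded_measurable_integrable.
Qed.

Lemma mean_cst mu (c : R) : mean mu (cst c) = c.
Proof. by rewrite /mean Rintegral_cst//= probability_setT /= mulr1. Qed.

Lemma meanD mu g h : bounded_measurable g -> bounded_measurable h ->
  mean mu (fun x => g x + h x) = mean mu g + mean mu h.
Proof. by move=> bg bh; rewrite /mean RintegralD//; exact: bounded_measurable_integrable. Qed.

Lemma meanZ mu (c : R) g : bounded_measurable g ->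
  mean mu (fun x => c * g x) = c * mean mu g.
Proof. by move=> bg; rewrite /mean RintegralZl//; exact: bounded_measurable_integrable. Qed.

Lemma mean_sum mu (I : Type) (s : seq I) (h : I -> T -> R) :
  (forall i, bounded_measurable (h i)) ->
  mean mu (fun x => \sum_(i <- s) h i x) = \sum_(i <- s) mean mu (h i).
Proof.
move=> bh; elim: s => [|i s IH].
  by under eq_fun do rewrite big_nil; rewrite big_nil mean_cst.
under eq_fun do rewrite big_cons.
by rewrite big_cons meanD ?IH//; exact: bounded_measurable_sum.
Qed.

Lemma mean_indic mu (A : set T) : measurable A -> mean mu \1_A = fine (mu A).
Proof. by move=> mA; rewrite /mean /Rintegral integral_indic// setIT. Qed.

Lemma le_mean mu g h : bounded_measurable g -> bounded_measurable h ->
  (forall x, g x <= h x) -> mean mu g <= mean mu h.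
Proof.
move=> bg bh gh; apply: le_Rintegral => //; exact: bounded_measurable_integrable.
Qed.

(** The conclusion only sees a set of full measure: [A] will be the compact set
    on which the pressure is computed. *)
Lemma ae_le_mean mu g h (A : set T) : measurable A -> mu A = 1%E ->
  bounded_measurable g -> bounded_measurable h ->
  (forall x, A x -> g x <= h x) -> mean mu g <= mean mu h.
Proof.
move=> mA muA bg bh gh.
suff onA u : bounded_measurable u -> mean mu u = \int[mu]_(x in A) u x.
  rewrite !onA//; apply: le_Rintegral => //; exact: bounded_measurable_integrable.
move=> bu; rewrite /mean /Rintegral; congr fine.
rewrite (@negligible_integral _ _ _ mu setT (~` A))//.
- by rewrite setTD setCK.
- exact: measurableC.
- exact: bounded_measurable_integrable.
- by have := probability_setC mu mA; rewrite /= muA subee.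
Qed.

Lemma mean_ge0 mu g : bounded_measurable g -> (forall x, 0 <= g x) ->
  0 <= mean mu g.
Proof. by move=> bg g0; rewrite -(mean_cst mu 0) le_mean//; exact: bounded_measurable_cst. Qed.

Lemma mean_comp mu g (u : T -> T) : measurable_fun setT u ->
  (forall A, measurable A -> mu (u @^-1` A) = mu A) ->
  bounded_measurable g -> mean mu (fun x => g (u x)) = mean mu g.
Proof.
move=> mu_u inv bg; rewrite /mean /Rintegral; congr fine.
have [mg _] := bg.
transitivity (\int[pushforward mu u]_x (g x)%:E)%E; last first.
  by apply: eq_measure_integral => A mA _ /=; rewrite /pushforward inv.
rewrite (@integral_pushforward _ _ _ _ _ _ mu_u mu setT (EFin \o g))//.
- exact/measurable_EFinP.
- by rewrite preimage_setT; apply: bounded_measurable_integrable => //; exact: bounded_measurable_comp.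
Qed.

Lemma le_fine_measure mu (A B : set T) : measurable A -> measurable B ->
  A `<=` B -> fine (mu A) <= fine (mu B).
Proof.
by move=> mA mB AB; rewrite fine_le ?fin_num_measure// le_measure ?inE.
Qed.

End Means.

(** * Compact metric spaces *)

Section CompactMetric.
Context {R : realType} {X : pointedMetricType R}.
Implicit Types (psi : X -> R) (O : set X) (e : R).

Lemma open_borel O : open O -> measurable (O : set (borel X)).
Proof. exact: sub_sigma_algebra. Qed.

Lemma closed_borel O : closed O -> measurable (O : set (borel X)).
Proof. by move=> /closed_openC/open_borel/measurableC; rewrite setCK. Qed.

Lemma lsc_measurable psi : (forall a, open [set x | a < psi x]) ->
  measurable_fun [set: borel X] psi.
Proof.
move=> lsc; apply: (measurability _ (RGenOInfty.measurableE R)).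
move=> /= _ [_ [a ->]] <-; apply: measurableI => //; apply: open_borel.
rewrite (_ : _ @^-1` _ = [set x | a < psi x])//.
by apply/seteqP; split=> x /=; rewrite in_itv/= andbT.
Qed.

Lemma continuous_superlevel_open psi a : continuous psi ->
  open [set x | a < psi x].
Proof.
by move=> cpsi; apply: (@open_comp _ _ psi [set y | a < y]) => [x _|]; [exact: cpsi|exact: open_gt].
Qed.

Lemma continuous_borel_fun (f : X -> X) : continuous f ->
  measurable_fun [set: borel X] (f : borel X -> borel X).
Proof.
move=> cf; apply: (@measurability _ _ (borel X) (borel X) setT f (@open X) erefl).
move=> /= _ [W oW <-]; rewrite setTI; apply: open_borel.
by apply: open_comp => // x _; exact: cf.
Qed.

Lemma iter_continuous (f : X -> X) n : continuous f -> continuous (iter n f).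
Proof.
by move=> cf; elim: n => [|n IH] x //=; apply: (continuous_comp (IH x)); exact: cf.
Qed.

Hypothesis cptX : compact [set: X].

(** A property that holds near each point at all small scales holds everywhere at
    all small scales: uniform continuity, Lebesgue numbers and the separation of
    closed sets are instances. *)
Lemma compact_uniformly (P : R -> X -> Prop) :
  (forall x, exists2 r, 0 < r & forall y e, ball x r y -> 0 < e < r -> P e y) ->
  exists2 r, 0 < r & forall e, 0 < e < r -> forall x, P e x.
Proof.
move=> loc; have /compact_near_coveringP cov := cptX.
have FF : Filter ((0 : R)^'+) by typeclasses eauto.
have := cov R ((0 : R)^'+) P FF; case.
  move=> x _; have [r r0 rP] := loc x.
  exists (ball x r, [set e | 0 < e < r]) => /=; last by case=> y e [/= xy er]; exact: rP.
  split; first exact: nbhsx_ballx.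
  near=> e; apply/andP; split; first by near: e; exact: nbhs_right_gt.
  by near: e; exact: nbhs_right_lt.
move=> r /= r0 rP; exists r => // e /andP[e0 er] x.
apply: rP => //=; by rewrite sub0r normrN gtr0_norm.
Unshelve. all: by end_near. Qed.

Lemma uniform_continuity psi : continuous psi -> forall eta, 0 < eta ->
  exists2 r, 0 < r & forall x y, ball x r y -> `|psi x - psi y| < eta.
Proof.
move=> cpsi eta eta0.
have [|r r0 rP] := @compact_uniformly
    (fun e x => forall y, ball x e y -> `|psi x - psi y| < eta).
  move=> x; have eta20 : 0 < eta / 2 by rewrite divr_gt0.
  have /cvgrPdist_lt/(_ _ eta20) := cpsi x.
  rewrite -nbhs_ballE => -[s /= s0 sP]; exists (s / 2); first by rewrite divr_gt0.
  move=> y e xy /andP[e0 es] z yz.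
  have xz : ball x s z.
    by rewrite [s]splitr; apply: (ball_triangle xy); apply: le_ball yz; exact: ltW.
  have {}xy : ball x s y by apply: le_ball xy; lra.
  rewrite -(subrKA (psi x)) [eta]splitr (le_lt_trans (ler_normD _ _))// ltrD//.
    by rewrite distrC; exact: sP.
  exact: sP.
exists (r / 2); first by rewrite divr_gt0.
move=> x y; apply: rP; rewrite divr_gt0//= ltr_pdivrMr// ltr_pMr// ltr1n//.
Qed.

Lemma lebesgue_number (U : seq (set X)) : finite_open_cover U ->
  exists2 r, 0 < r & forall x, exists2 A, A \in U & ball x r `<=` A.
Proof.
move=> [oU cU].
have [|r r0 rP] := @compact_uniformly
    (fun e x => exists2 A, A \in U & ball x e `<=` A).
  move=> x; have [A /= AU Ax] : (\bigcup_(A in [set` U]) A) x by rewrite cU.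
  have := oU _ AU; rewrite openE => /(_ _ Ax); rewrite /interior -nbhs_ballE.
  move=> [s /= s0 sA]; exists (s / 2); first by rewrite divr_gt0.
  move=> y e xy /andP[e0 es]; exists A => // z yz; apply: sA.
  by rewrite [s]splitr; apply: (ball_triangle xy); apply: le_ball yz; exact: ltW.
exists (r / 2); first by rewrite divr_gt0.
by move=> x; apply: rP; rewrite divr_gt0//= ltr_pdivrMr// ltr_pMr// ltr1n.
Qed.

Lemma continuous_bounded psi : continuous psi -> exists M, forall x, `|psi x| <= M.
Proof.
move=> cpsi.
have : compact (psi @` setT).
  by apply: continuous_compact => //; apply: continuous_subspaceT.
move=> /compact_bounded[M [_ /(_ (M + 1))]]; rewrite ltrDl ltr01 => /(_ isT) MP.
by exists (M + 1) => x; apply: MP; exists x.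
Qed.

Lemma continuous_bounded_measurable psi : continuous psi ->
  @bounded_measurable R _ (borel X) psi.
Proof.
move=> cpsi; split; last exact: continuous_bounded.
by apply: lsc_measurable => a; exact: continuous_superlevel_open.
Qed.

End CompactMetric.

(** * Approximation of open sets from within *)

Section Erosion.
Context {R : realType} {X : pointedMetricType R}.
Implicit Types (O : set X) (e : R).

(** Closed sets that increase to [O], if [O] is open, as [e] decreases to 0, and
    that depend monotonically on [O]. *)
Definition erosion e O : set X := [set x | ball x e `<=` O].

Lemma erosion_sub e O : 0 < e -> erosion e O `<=` O.
Proof. by move=> e0 x; apply; exact: ballxx. Qed.

Lemma le_erosion e e' O : e <= e' -> erosion e' O `<=` erosion e O.
Proof. by move=> ee x Ox y /(le_ball ee)/Ox. Qed.

Lemma closed_erosion e O : 0 < e -> closed (erosion e O).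
Proof.
move=> e0; rewrite -[erosion e O]setCK; apply: open_closedC; rewrite openE => x.
move=> /existsNP[y /not_implyP[xy nOy]].
move: xy; rewrite ballEmdist/= => xy.
rewrite /interior -nbhs_ballE; exists (e - mdist x y); first by rewrite /= subr_gt0.
move=> z; rewrite ballEmdist/= => xz; apply/existsNP; exists y; apply/not_implyP.
split=> //; rewrite ballEmdist/=.
by rewrite (le_lt_trans (metric_triangle _ x _))// metric_sym addrC -ltrBrDl.
Qed.

Lemma erosion_measure_approx (mu : probability (borel X) R) O : open O ->
  forall eta, 0 < eta -> exists2 e, 0 < e & fine (mu O) <= fine (mu (erosion e O)) + eta.
Proof.
move=> oO eta eta0; pose A n : set (borel X) := erosion n.+1%:R^-1 O.
have mA n : measurable (A n) by apply: closed_borel; exact: closed_erosion.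
have UA : \bigcup_n A n = O.
  apply/seteqP; split=> [x [n _]|x Ox]; first exact: erosion_sub.
  have := oO; rewrite openE => /(_ _ Ox); rewrite /interior -nbhs_ballE => -[e /= e0 eO].
  near \oo => n; exists n => //; apply: le_erosion eO; apply: ltW; near: n.
  exact: near_infty_natSinv_lt (PosNum e0).
have ndA : nondecreasing_seq A.
  move=> n m nm; apply/subsetPset; apply: le_erosion.
  by rewrite lef_pV2 ?posrE// ler_nat.
have : mu (A n) @[n --> \oo] --> (fine (mu O))%:E.
  rewrite fineK; last by apply: fin_num_measure; exact: open_borel.
  rewrite -UA; apply: nondecreasing_cvg_mu => //; rewrite UA; exact: open_borel.
move=> /fine_cvgP[_].
move/cvgrPdist_le => /(_ _ eta0)[n _ /(_ n (leqnn n))] h.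
exists n.+1%:R^-1 => //; rewrite -lerBlDl; exact: le_trans (ler_norm _) h.
Unshelve. all: by end_near. Qed.

End Erosion.

(** * Positive functionals and layer sums *)

(** Bounded real functions, without measurability: the domain of the averages
    along an orbit and of their limits. *)
Definition bounded_function {R : realType} {T : Type} (g : T -> R) :=
  exists M : R, forall x, `|g x| <= M.

Section PositiveFunctionals.
Context {R : realType} {T : Type}.
Implicit Types (g h : T -> R).

(** Averages along an orbit, their limits along an ultrafilter and means with
    respect to a measure all have these properties; normalization is kept apart,
    as it fails for the empty average. *)
Definition positive_functional (L : (T -> R) -> R) :=
  [/\ forall g h, bounded_function g -> bounded_function h ->
        L (fun x => g x + h x) = L g + L h,
      forall c g, bounded_function g -> L (fun x => c * g x) = c * L g &
      forall g h, bounded_function g -> bounded_function h ->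
        (forall x, g x <= h x) -> L g <= L h].

Lemma bounded_function_cst (c : R) : bounded_function (fun _ : T => c).
Proof. by exists `|c|. Qed.

Lemma bounded_functionD g h : bounded_function g -> bounded_function h ->
  bounded_function (fun x => g x + h x).
Proof.
move=> [M gM] [N hN]; exists (M + N) => x.
by rewrite (le_trans (ler_normD _ _))// lerD.
Qed.

Lemma bounded_functionZ c g : bounded_function g ->
  bounded_function (fun x => c * g x).
Proof. by move=> [M gM]; exists (`|c| * M) => x; rewrite normrM ler_wpM2l. Qed.

Lemma bounded_function_indic (A : set T) : bounded_function (\1_A : T -> R).
Proof.
exists 1 => x; rewrite indicE; case: (x \in A) => /=; first by rewrite normr1.
by rewrite normr0.
Qed.

Lemma bounded_function_sum (I : Type) (s : seq I) (h : I -> T -> R) :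
  (forall i, bounded_function (h i)) ->
  bounded_function (fun x => \sum_(i <- s) h i x).
Proof.
move=> bh; elim: s => [|i s IH].
  by under eq_fun do rewrite big_nil; exact: bounded_function_cst.
by under eq_fun do rewrite big_cons; exact: bounded_functionD.
Qed.

Lemma positive_functional_sum L (I : Type) (s : seq I) (h : I -> T -> R) :
  positive_functional L -> (forall i, bounded_function (h i)) ->
  L (fun x => \sum_(i <- s) h i x) = \sum_(i <- s) L (h i).
Proof.
move=> [LD LZ _] bh; elim: s => [|i s IH].
  under eq_fun do rewrite big_nil.
  transitivity (L (fun=> 0 * 0)); first by rewrite mul0r.
  by rewrite (LZ 0 (fun=> 0)) ?mul0r ?big_nil//; exact: bounded_function_cst.
under eq_fun do rewrite big_cons.
by rewrite big_cons LD ?IH//; exact: bounded_function_sum.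
Qed.

(** The lower sum of the layer-cake formula for a function with values in the
    unit interval, with mesh 1/N. *)
Definition layer_sum (N : nat) h (x : T) : R :=
  \sum_(j < N) N%:R^-1 * \1_[set y | j.+1%:R / N%:R < h y] x.

Lemma layer_sum_bounds (N : nat) h x : (0 < N)%N -> 0 <= h x <= 1 ->
  layer_sum N h x <= h x <= layer_sum N h x + N%:R^-1.
Proof.
move=> N0 /andP[h0 h1]; have N0' : 0 < N%:R :> R by rewrite ltr0n.
pose c (j : nat) : R := Num.min (h x) (j%:R / N%:R).
(* [c j] truncates [h] at height j/N; the increments of [c] telescope. *)
have cS j : N%:R^-1 * \1_[set y | j.+1%:R / N%:R < h y] x <= c j.+1 - c j
          /\ c j.+2 - c j.+1 <= N%:R^-1 * \1_[set y | j.+1%:R / N%:R < h y] x.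
  rewrite indicE /c; have jj (i : nat) : i.+1%:R / N%:R = i%:R / N%:R + N%:R^-1 :> R.
    by rewrite -natr1 mulrDl mul1r.
  have Ni : 0 < N%:R^-1 :> R by rewrite invr_gt0.
  rewrite (jj j.+1); have {}jj := jj j; rewrite jj; have [hx|hx] := ltP (j%:R / N%:R + N%:R^-1) (h x).
    rewrite mem_set ?mulr1 ?minEle//.
    by split; move: hx; do !case: ifPn; rewrite -?ltNge; lra.
  rewrite memNset ?mulr0 ?minEle//; last by apply/negP; rewrite -leNgt.
  by split; move: hx; do !case: ifPn; rewrite -?ltNge; lra.
have c0 : c 0%N = 0 by rewrite /c mul0r min_r.
have cN : c N = h x by rewrite /c divff ?gt_eqF// min_l.
have c1 : c 1%N <= N%:R^-1 by rewrite /c ge_min mul1r lexx orbT.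
have tel (a b : nat) : (a <= b)%N -> \sum_(a <= j < b) (c j.+1 - c j) = c b - c a.
  by move=> ab; rewrite telescope_sumr.
apply/andP; split.
  have -> : h x = c N - c 0%N by rewrite c0 cN subr0.
  rewrite -tel// big_mkord.
  by apply: ler_sum => j _; have [] := cS j.
rewrite -lerBlDr; have : c N.+1 - c 1%N <= layer_sum N h x.
  rewrite -tel// big_add1/= big_mkord.
  by apply: ler_sum => j _; have [] := cS j.
apply: le_trans; apply: lerB => //; rewrite /c le_min lexx/=.
rewrite (le_trans h1)// ler_pdivlMr// mul1r ler_nat; exact: leqW.
Qed.

End PositiveFunctionals.

(** * Domination of a measure on open sets *)

Section Portmanteau.
Context {R : realType} {X : pointedMetricType R}.
Implicit Types (h psi : X -> R) (mu : probability (borel X) R).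

(** Domination on open sets passes to lower semicontinuous functions, because
    these are uniform limits of combinations of open superlevel sets. *)
Lemma near_lsc_mean_le (I : Type) (F : set_system I) (FF : Filter F)
    (L : I -> (X -> R) -> R) mu h :
  (forall i, positive_functional (L i)) ->
  (forall O eta, open O -> 0 < eta ->
     \forall i \near F, fine (mu O) <= L i \1_O + eta) ->
  (forall a, open [set x | a < h x]) -> (forall x, 0 <= h x <= 1) ->
  forall eta, 0 < eta -> \forall i \near F, mean mu h <= L i h + eta.
Proof.
move=> Lpos Lopen lsch h01 eta eta0.
have eta20 : 0 < eta / 2 by rewrite divr_gt0.
have bh : bounded_function h.
  by exists 1 => x; have /andP[h0 h1] := h01 x; rewrite ger0_norm.
have bmh : @bounded_measurable R _ (borel X) h by split => //; exact: lsc_measurable.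
near (\oo : set_system nat) => N.
have N0 : (0 < N)%N by near: N; exact: nbhs_infty_gt.
have N0' : 0 < N%:R :> R by rewrite ltr0n.
have Neta : N%:R^-1 <= eta / 2.
  have -> : N%:R^-1 = N.-1.+1%:R^-1 :> R by rewrite prednK.
  apply: ltW; near: N.
  have [m _ mP] := near_infty_natSinv_lt (PosNum eta20).
  by exists m.+1 => // -[//|N] /= mN; exact: mP.
pose O (j : 'I_N) := [set y | j.+1%:R / N%:R < h y].
have : \forall i \near F, forall j, fine (mu (O j)) <= L i \1_(O j) + eta / 2.
  by apply: filter_forall => j; apply: Lopen => //; exact: lsch.
apply: filterS => i iP.
have mO j : measurable (O j : set (borel X)) by apply: open_borel; exact: lsch.
have bmO j : @bounded_measurable R _ (borel X) (fun x => N%:R^-1 * \1_(O j) x).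
  by apply: bounded_measurableZ; exact: bounded_measurable_indic.
have bO j : bounded_function (fun x => N%:R^-1 * \1_(O j) x : R).
  by apply: bounded_functionZ; exact: bounded_function_indic.
have [LD LZ Lmon] := Lpos i.
have lay : L i (layer_sum N h) <= L i h.
  apply: Lmon => //; first exact: bounded_function_sum.
  by move=> x; have /andP[] := layer_sum_bounds N0 (h01 x).
apply: (@le_trans _ _ (mean mu (layer_sum N h) + N%:R^-1)).
  rewrite -(mean_cst mu N%:R^-1) -meanD; last 2 first.
  - exact: bounded_measurable_sum.
  - exact: bounded_measurable_cst.
  apply: le_mean => //.
    by apply: bounded_measurableD; [exact: bounded_measurable_sum|exact: bounded_measurable_cst].
  by move=> x; have /andP[] := layer_sum_bounds N0 (h01 x).
rewrite [eta]splitr addrA lerD//; apply: le_trans; last by apply: lerD; [exact: lay|exact: lexx].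
rewrite /layer_sum mean_sum// positive_functional_sum//.
apply: (@le_trans _ _ (\sum_(j < N) (L i (fun x => N%:R^-1 * \1_(O j) x) + N%:R^-1 * (eta / 2)))).
  apply: ler_sum => j _; rewrite meanZ; last by apply: bounded_measurable_indic; exact: mO.
  rewrite LZ; last exact: bounded_function_indic.
  by rewrite (mean_indic mu (mO j)) -mulrDr ler_wpM2l.
rewrite big_split/= lerD// sumr_const card_ord -[leLHS]mulr_natl mulVKf//.
by rewrite gt_eqF.
Unshelve. all: by end_near. Qed.

End Portmanteau.

(** * Extension of a content to a Borel measure *)

Section ContentExtension.
Context {R : realType} {X : pointedMetricType R}.
Implicit Types (A B O G : set X) (e : R).

Definition finitely_additive_probability (lam : set X -> R) :=
  [/\ lam setT = 1, forall A, 0 <= lam A &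
      forall A B, A `&` B = set0 -> lam (A `|` B) = lam A + lam B].

Variable lam : set X -> R.
Hypothesis lam_prob : finitely_additive_probability lam.
Hypothesis cptX : compact [set: X].

Let lamD A B : A `&` B = set0 -> lam (A `|` B) = lam A + lam B.
Proof. by move=> ?; have [_ _ ->] := lam_prob. Qed.

Let lam_ge0 A : 0 <= lam A. Proof. by have [_ ->] := lam_prob. Qed.

Let lamT : lam setT = 1. Proof. by have [->] := lam_prob. Qed.

Let lam0 : lam set0 = 0.
Proof.
by have := lamD (setI0 set0); rewrite setU0 -{1}[lam set0]addr0 => /addrI.
Qed.

Let le_lam A B : A `<=` B -> lam A <= lam B.
Proof.
by move=> AB; rewrite -(setDUK AB) lamD ?lerDl// setDIK.
Qed.

Let lam_le1 A : lam A <= 1. Proof. by rewrite -lamT le_lam. Qed.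

Let lamU A B : lam (A `|` B) <= lam A + lam B.
Proof.
have -> : A `|` B = A `|` (B `\` A).
  by apply/seteqP; split=> x [Ax|Bx]; [left| |left|right; case: Bx] => //;
     have [Ax|nAx] := pselect (A x); [left|right].
by rewrite lamD ?setDIK// lerD2l le_lam.
Qed.

Local Open Scope ereal_scope.

Let tau O : \bar R := ereal_sup [set (lam (erosion e O))%:E | e in [set e | (0 < e)%R]].

Let le_tau_lam O : tau O <= (lam O)%:E.
Proof.
by apply: ge_ereal_sup => _ [e /= e0 <-]; rewrite lee_fin le_lam//; exact: erosion_sub.
Qed.

Let erosion_le_tau O e : (0 < e)%R -> (lam (erosion e O))%:E <= tau O.
Proof. by move=> e0; apply: ereal_sup_ubound; exists e. Qed.

Let tau_ge0 O : 0 <= tau O.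
Proof. by apply: (le_trans _ (erosion_le_tau O ltr01)); rewrite lee_fin. Qed.

Let tau_le1 O : tau O <= 1.
Proof. by apply: (le_trans (le_tau_lam O)); rewrite lee_fin. Qed.

Let le_tau O G : O `<=` G -> tau O <= tau G.
Proof.
move=> OG; apply: ge_ereal_sup => _ [e /= e0 <-].
apply: (le_trans _ (erosion_le_tau G e0)); rewrite lee_fin le_lam// => x Ox y.
by move/Ox/OG.
Qed.

Let tauT : tau setT = 1.
Proof.
apply/eqP; rewrite eq_le tau_le1/=.
apply: (le_trans _ (erosion_le_tau setT ltr01)); rewrite lee_fin.
by rewrite -lamT le_lam// => x _ y _.
Qed.

(* An eroded union is compact, so it is covered by erosions, of one common
   width, of finitely many of the members. *)
Let tau_sigma_subadditive (O : nat -> set X) : (forall i, open (O i)) ->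
  tau (\bigcup_i O i) <= \sum_(i <oo) tau (O i).
Proof.
move=> oO; apply: ge_ereal_sup => _ [e /= e0 <-].
pose K := erosion e (\bigcup_i O i).
have cK : compact K by exact: (subclosed_compact (closed_erosion (O:=_) e0) cptX (@subsetT _ _)).
pose V n := \bigcup_(i in `I_n) erosion (n.+1%:R^-1 : R)%R (O i).
have [n KV] : exists n, K `<=` V n.
  have /compact_near_coveringP cov := cK.
  have [|n _ nP] := cov nat \oo (fun n x => V n x) _; last by exists n; exact: (nP n (leqnn n)).
  move=> x /(erosion_sub e0)[i _ Oix].
  have := oO i; rewrite openE => /(_ _ Oix); rewrite /interior -nbhs_ballE.
  move=> [r /= r0 rO]; have r20 : (0 < r / 2)%R by rewrite divr_gt0.
  exists (ball x (r / 2)%R, [set n | (i < n)%N /\ (n.+1%:R^-1 < r / 2)%R]) => /=.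
    split; first exact: nbhsx_ballx.
    near=> n; split; first by near: n; exact: nbhs_infty_gt.
    by near: n; exact: near_infty_natSinv_lt (PosNum r20).
  move=> [y k] [/= xy [ik kr]]; exists i => // z yz; apply: rO.
  by rewrite [r]splitr; apply: (ball_triangle xy); apply: le_ball yz; exact: ltW.
have : (lam K <= \sum_(i < n) lam (erosion n.+1%:R^-1 (O i)))%R.
  apply: (le_trans (le_lam KV)); rewrite /V bigcup_mkord.
  elim/big_ind2 : _ => [|A a B b Aa Bb|//]; first by rewrite lam0.
  by rewrite (le_trans (lamU _ _))// lerD.
rewrite -lee_fin => /le_trans; apply; rewrite -sumEFin.
apply: (@le_trans _ _ (\sum_(i < n) tau (O i))).
  by apply: lee_sum => i _; apply: erosion_le_tau.
by rewrite -(big_mkord xpredT (fun i => tau (O i))); apply: nneseries_lim_ge => i _ _.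
Unshelve. all: by end_near. Qed.

Let mustar A : \bar R := ereal_inf [set tau O | O in [set O | open O /\ A `<=` O]].

Let mustar_open O : open O -> mustar O = tau O.
Proof.
move=> oO; apply/eqP; rewrite eq_le; apply/andP; split.
  by apply: ereal_inf_lbound; exists O => //; split.
by apply: le_ereal_inf_tmp => _ [G [oG OG] <-]; exact: le_tau.
Qed.

Let le_mustar_tau A O : open O -> A `<=` O -> mustar A <= tau O.
Proof. by move=> oO AO; apply: ereal_inf_lbound; exists O. Qed.

Let mustar_ge0 A : 0 <= mustar A.
Proof. by apply: le_ereal_inf_tmp => _ [G _ <-]. Qed.

Let mustar_fin A : mustar A \is a fin_num.
Proof.
rewrite ge0_fin_numE//; apply: le_lt_trans (le_mustar_tau openT _) _ => //.
by rewrite tauT ltry.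
Qed.

Let le_mustar A B : A `<=` B -> mustar A <= mustar B.
Proof.
move=> AB; apply: le_ereal_inf_tmp => _ [G [oG BG] <-].
by apply: le_mustar_tau => //; exact: subset_trans BG.
Qed.

Let mustar0 : mustar set0 = 0.
Proof.
rewrite mustar_open; last exact: open0.
by apply/eqP; rewrite eq_le tau_ge0 andbT (le_trans (le_tau_lam _))// lam0.
Qed.

Let mustar_sigma_subadditive : sigma_subadditive mustar.
Proof.
move=> F; apply/lee_addgt0Pr => eps eps0.
have eps_gt0 n : (0 < eps / (2 ^ n.+1)%:R)%R by rewrite divr_gt0// ltr0n expn_gt0.
have /choice[G GP] : forall n, exists G, [/\ open G, F n `<=` G &
    tau G <= mustar (F n) + (eps / (2 ^ n.+1)%:R)%:E].
  move=> n; have [_ [G [oG FG] <-] tG] := lb_ereal_inf_adherent (eps_gt0 n) (mustar_fin (F n)).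
  by exists G; split=> //; exact: ltW.
apply: le_trans (epsilon_trick xpredT _ (ltW eps0)); last by move=> n; exact: mustar_ge0.
apply: (@le_trans _ _ (\sum_(n <oo) tau (G n))).
  apply: le_trans (tau_sigma_subadditive _); last by move=> n; have [] := GP n.
  apply: le_mustar_tau; first by apply: bigcup_open => n _; have [] := GP n.
  by apply: subset_bigcup => n _; have [] := GP n.
by apply: lee_nneseries => // n _; have [] := GP n.
Qed.

Let mustarM : {outer_measure set X -> \bar R} :=
  HB.pack mustar (isOuterMeasure.Build R X mustar mustar0 mustar_ge0 le_mustar
    mustar_sigma_subadditive).

Let open_caratheodory G : open G -> mustarM.-caratheodory G.
Proof.
move=> oG; apply: le_caratheodory_measurable => A.
change (mustar (A `&` G) + mustar (A `&` ~` G) <= mustar A).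
apply: le_ereal_inf_tmp => _ [W [oW AW] <-].
have oWG : open (W `&` G) by exact: openI.
apply: (@le_trans _ _ (tau (W `&` G) + mustar (A `&` ~` G))).
  by rewrite leeD2r//; apply: le_mustar_tau => //; exact: setSI.
rewrite -leeBrDr//; apply: ge_ereal_sup => _ [e /= e0 <-].
rewrite leeBrDr// addeC -leeBrDr//.
(* [K] and an erosion of its complement in [W] are disjoint parts of one erosion
   of [W], so additivity of the content applies. *)
pose K := erosion e (W `&` G).
have oWK : open (W `\` K) by rewrite setDE; apply: openI => //; apply: closed_openC; exact: closed_erosion.
apply: (@le_trans _ _ (tau (W `\` K))).
  apply: le_mustar_tau => // x [Ax nGx]; split; first exact: AW.
  by move/(erosion_sub e0) => [].
apply: ge_ereal_sup => _ [s /= s0 <-]; rewrite EFinN leeBrDr// -EFinD -lamD.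
  have m0 : (0 < Num.min e s)%R by rewrite lt_min e0.
  apply: le_trans (erosion_le_tau W m0); rewrite lee_fin le_lam// => x [].
    move=> Kx y xy; apply: (proj1 (Kx _ _)).
    by apply: le_ball xy; rewrite ge_min lexx orbT.
  by move=> Kx y xy; apply: (proj1 (Kx _ _)); apply: le_ball xy; rewrite ge_min lexx.
apply/seteqP; split=> // x [Ks Kx].
by have [] := erosion_sub s0 Ks.
Qed.

(** A finitely additive [lam] need not be countably additive, but its regularized
    value on open sets, the supremum over erosions, is countably subadditive by
    compactness.  It generates an outer measure whose Caratheodory sets include the
    open ones.  Mass of [lam] near the boundary of an open set is lost to the
    complement, which is why there is only an inequality. *)
Lemma content_extension : exists mu : probability (borel X) R,
  forall O, open O -> mu O <= (lam O)%:E.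
Proof.
pose nu (A : set (borel X)) := mustar A.
have borel_cara A : measurable (A : set (borel X)) -> mustarM.-caratheodory A.
  move: A; apply: smallest_sub; last by move=> G; exact: open_caratheodory.
  split.
  - exact: caratheodory_measurable_set0.
  - by move=> A mA; rewrite setTD; exact: caratheodory_measurable_setC.
  - by move=> A mA; exact: caratheodory_measurable_bigcup.
have nu_sigma : semi_sigma_additive nu.
  move=> F mF tF mUF.
  apply: (@caratheodory_measure_sigma_additive R X mustarM F) => //.
  - by move=> i; exact: borel_cara.
  - exact: borel_cara.
pose m : {measure set (borel X) -> \bar R} := HB.pack nu
  (isMeasure.Build _ _ R nu mustar0 mustar_ge0 nu_sigma).
have nuT : nu setT = 1 by rewrite /nu mustar_open ?tauT//; exact: openT.
pose mu : probability (borel X) R := HB.pack nu (isMeasure.Build _ _ R nu mustar0 mustar_ge0 nu_sigma)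
  (Measure_isProbability.Build _ _ _ m nuT).
by exists mu => O oO; change (mustar O <= (lam O)%:E); rewrite mustar_open.
Qed.

End ContentExtension.

(** * Orbit averages *)

Section OrbitAverages.
Context {R : realType} {X : pointedMetricType R}.
Variable f : X -> X.
Implicit Types (g psi : X -> R) (x : X) (O : set X) (mu nu : probability (borel X) R).
Hypothesis cptX : compact [set: X].

Definition orbit_average x n g : R := n%:R^-1 * birkhoff_sum f g n x.

Lemma orbit_average_positive x n : positive_functional (orbit_average x n).
Proof.
rewrite /orbit_average /birkhoff_sum; split=> [g h _ _|c g _|g h _ _ gh].
- by rewrite big_split mulrDr.
- by rewrite -mulr_sumr mulrCA.
- by rewrite ler_wpM2l// ?invr_ge0// ler_sum.
Qed.

Lemma orbit_average1 x n : (0 < n)%N -> orbit_average x n (fun=> 1) = 1.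
Proof.
move=> n0; rewrite /orbit_average /birkhoff_sum sumr_const card_ord.
by rewrite mulVf// pnatr_eq0 -lt0n.
Qed.

Lemma orbit_average_comp x n g :
  orbit_average x n (g \o f) - orbit_average x n g =
  n%:R^-1 * (g (iter n f x) - g x).
Proof.
rewrite /orbit_average -mulrBr; congr (_ * _); rewrite /birkhoff_sum -sumrB.
rewrite -(big_mkord xpredT (fun k => (g \o f) (iter k f x) - g (iter k f x))).
by rewrite (telescope_sumr (fun k => g (iter k f x))).
Qed.

Lemma integral_empirical_measure x n psi : measurable_fun [set: borel X] psi ->
  (\int[empirical_measure f x n]_(y in [set: borel X]) (psi y)%:E)%E =
  (orbit_average x n psi)%:E.
Proof.
move=> mpsi.
pose m_ k : {measure set (borel X) -> \bar R} := \d_(iter k f x : borel X).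
have ge0E (h : borel X -> \bar R) : measurable_fun setT h -> (forall y, 0 <= h y)%E ->
    (\int[empirical_measure f x n]_(y in setT) h y =
    (n%:R^-1)%:E * \sum_(k < n) h (iter k f x))%E.
  move=> mh h0; rewrite /empirical_measure.
  rewrite (@ge0_integral_mscale _ _ _ (msum m_ n) setT measurableT _ h)//=.
  rewrite (@ge0_integral_measure_sum _ _ _ m_ setT measurableT h)//.
  congr (_ * _)%E; apply: eq_bigr => k _.
  by rewrite integral_dirac// diracT mul1e.
have mE : measurable_fun [set: borel X] (EFin \o psi) by exact/measurable_EFinP.
rewrite integralE !ge0E//; last 2 first.
- exact: measurable_funeneg.
- exact: measurable_funepos.
rewrite -muleBr//; last 1 first.
  by rewrite fin_num_adde_defr//; apply/sum_fin_numP => k _ _; rewrite funeposE /= -EFin_max.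
rewrite /orbit_average EFinM; congr (_ * _)%E; rewrite /birkhoff_sum -sumEFin.
rewrite -(@fin_num_sumeN _ _ _ _ (fun k : 'I_n => ((EFin \o psi)^\- (iter k f x))%E)); last first.
  by move=> k _; rewrite funenegE /= -EFin_max.
rewrite -big_split/=; apply: eq_bigr => k _.
exact/esym/(congr1 (@^~ (iter k f x)) (funeposneg (EFin \o psi))).
Qed.

Lemma weak_star_orbit_average x (n_ : nat -> nat) mu :
  weak_star_cvg (fun k => empirical_measure f x (n_ k)) mu <->
  forall psi, continuous psi -> orbit_average x (n_ k) psi @[k --> \oo] --> mean mu psi.
Proof.
split=> [cv psi cpsi|cv psi cpsi];
    have bpsi := continuous_bounded_measurable cptX cpsi;
    have intE : (fun k => (\int[empirical_measure f x (n_ k)]_(y in [set: borel X])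
        (psi y)%:E)%E) = (fun k => (orbit_average x (n_ k) psi)%:E)
      by (apply/funext => k; apply: integral_empirical_measure; case: bpsi).
  have := cv psi cpsi; rewrite mean_EFin// intE//.
  by move/fine_cvgP => -[].
rewrite mean_EFin// intE//.
by apply: cvg_EFin; [exact: nearW|exact: cv].
Qed.

End OrbitAverages.

(** * Weak limits *)

Section WeakLimits.
Context {R : realType} {X : pointedMetricType R}.
Implicit Types (g psi : X -> R) (x : X) (O : set X) (mu nu : probability (borel X) R).
Hypothesis cptX : compact [set: X].

Lemma erosion_separation O e : open O -> 0 < e -> exists u : X -> R,
  [/\ continuous u, forall x, 0 <= u x <= 1, forall x, erosion e O x -> u x = 1 &
      forall x, u x <= \1_O x].
Proof.
move=> oO e0.
have sep : uniform_separator (~` O) (erosion e O).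
  have /(@normal_separatorP R) := @pseudometric_normal R X; apply.
  - exact: open_closedC.
  - exact: closed_erosion.
  - by apply/seteqP; split=> // x [nOx /(erosion_sub e0)].
pose u : X -> R := Urysohn (~` O) (erosion e O).
have u01 x : 0 <= u x <= 1.
  by have := @Urysohn_range X R (~` O) (erosion e O) (u x); rewrite /= in_itv/=; apply; exists x.
exists u; split => //.
- exact: Urysohn_continuous.
- by move=> x Ox; apply: (Urysohn_sub1 sep); exists x.
move=> x; rewrite indicE; case: (boolP (x \in O)) => [_|/negP xO].
  by case/andP: (u01 x).
rewrite (_ : u x = 0)//; apply: (Urysohn_sub0 sep); exists x => //.
by move=> Ox; apply: xO; rewrite inE.
Qed.

(** Urysohn functions of the erosions exhaust an open set in mean. *)
Lemma open_le_mean mu O eta : open O -> 0 < eta -> exists u : X -> R,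
  [/\ continuous u, forall x, 0 <= u x <= 1, fine (mu O) <= mean mu u + eta &
      forall x, u x <= \1_O x].
Proof.
move=> oO eta0; have [e e0 mue] := erosion_measure_approx mu oO eta0.
have [u [cu u01 u1 uO]] := erosion_separation oO e0.
exists u; split=> //; apply: (le_trans mue); rewrite lerD2r.
have me : measurable (erosion e O : set (borel X)) by apply: closed_borel; exact: closed_erosion.
rewrite -(mean_indic mu me); apply: le_mean.
- exact: bounded_measurable_indic.
- exact: continuous_bounded_measurable.
move=> x; rewrite indicE; case: (boolP (x \in _)) => [|_].
  by rewrite inE => /u1 ->.
by case/andP: (u01 x).
Qed.

Lemma mean_le_open mu (u : X -> R) O : open O -> continuous u ->
  (forall x, u x <= \1_O x) -> mean mu u <= fine (mu O).
Proof.
move=> oO cu uO; have mO := open_borel oO.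
rewrite -(mean_indic mu mO); apply: le_mean => //.
- exact: continuous_bounded_measurable.
- exact: bounded_measurable_indic.
Qed.

Lemma eq_mean_probability mu nu :
  (forall psi, continuous psi -> mean mu psi = mean nu psi) ->
  forall A : set (borel X), measurable A -> mu A = nu A.
Proof.
move=> eqm; apply: (@measure_unique _ _ (borel X) (@open X) (fun=> setT)) => //.
- exact: openI.
- by move=> _; exact: openT.
- by rewrite bigcup_const//; exists 0%N.
- suff le (P Q : probability (borel X) R) :
      (forall psi, continuous psi -> mean P psi = mean Q psi) ->
      forall W, open W -> fine (P W) <= fine (Q W).
    move=> W oW; have mW := open_borel oW.
    rewrite -[LHS]fineK ?fin_num_measure// -[RHS]fineK ?fin_num_measure//.
    by congr _%:E; apply/eqP; rewrite eq_le !le// => psi /eqm.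
  move=> eqPQ W oW; apply/ler_addgt0Pr => eta eta0.
  have [u [cu u01 Pu uW]] := open_le_mean P oW eta0.
  by apply: (le_trans Pu); rewrite eqPQ// lerD2r; exact: mean_le_open.
- by move=> _; rewrite (le_lt_trans (probability_le1 mu measurableT))// ltry.
Qed.

Lemma portmanteau_open (f : X -> X) x (n_ : nat -> nat) mu :
  (forall psi, continuous psi ->
     orbit_average f x (n_ k) psi @[k --> \oo] --> mean mu psi) ->
  forall O eta, open O -> 0 < eta ->
  \forall k \near \oo, fine (mu O) <= orbit_average f x (n_ k) \1_O + eta.
Proof.
move=> cv O eta oO eta0; have eta20 : 0 < eta / 2 by rewrite divr_gt0.
have [u [cu u01 muu uO]] := open_le_mean mu oO eta20.
have /cvgrPdist_le/(_ _ eta20) := cv u cu; apply: filterS => k.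
move=> /(le_trans (ler_norm _)); rewrite lerBlDl => muk.
have [_ _ mon] := orbit_average_positive f x (n_ k).
have := mon u \1_O (continuous_bounded cptX cu) (bounded_function_indic _) uO.
by move: muu muk; lra.
Qed.

(** A probability dominated by a positive functional on open sets agrees with
    it on continuous functions: domination for psi and for 1 - psi. *)
Lemma mean_of_open_domination (L : (X -> R) -> R) mu :
  positive_functional L -> L (fun=> 1) = 1 ->
  (forall O, open O -> fine (mu O) <= L \1_O) ->
  forall psi, continuous psi -> mean mu psi = L psi.
Proof.
move=> Lpos L1 Lopen psi cpsi; have [LD LZ Lmon] := Lpos.
have le01 (u : X -> R) : continuous u -> (forall x, 0 <= u x <= 1) -> mean mu u <= L u.
  move=> cu u01; apply/ler_addgt0Pr => eta eta0.
  have : \forall i \near globally [set: unit], mean mu u <= (fun=> L) i u + eta.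
    apply: (@near_lsc_mean_le R X unit (globally setT) _ (fun=> L) mu u) => //; last by move=> a; exact: continuous_superlevel_open.
    by move=> W s oW s0 _ _; rewrite (le_trans (Lopen _ oW))// lerDl ltW.
  exact: (fun H => H tt I).
have Lc c : L (fun=> c) = c.
  rewrite -[RHS]mulr1 -L1 -LZ; last exact: bounded_function_cst.
  by congr L; apply/funext => x; rewrite mulr1.
have eq01 (u : X -> R) : continuous u -> (forall x, 0 <= u x <= 1) -> mean mu u = L u.
  move=> cu u01; apply/eqP; rewrite eq_le le01//=.
  have bu := continuous_bounded cptX cu.
  have bmu := continuous_bounded_measurable cptX cu.
  have := le01 (fun x => 1 + -1 * u x).
  rewrite meanD ?meanZ ?LD ?LZ ?mean_cst ?L1//; last 4 first.
  - exact: bounded_function_cst.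
  - exact: bounded_functionZ.
  - exact: bounded_measurable_cst.
  - exact: bounded_measurableZ.
  move=> h; suff : 1 + -1 * mean mu u <= 1 + -1 * L u by lra.
  apply: h.
    by move=> x; apply: cvgD; [exact: cvg_cst|apply: cvgM; [exact: cvg_cst|exact: cu]].
  by move=> x; move: (u01 x) => /andP[u0 u1]; apply/andP; split; lra.
have [M psiM] := continuous_bounded cptX cpsi.
pose N := M + 1; have N0 : 0 < N.
  by rewrite ltr_wpDl// (le_trans (normr_ge0 _) (psiM point)).
pose u x := (2 * N)^-1 * (N + psi x).
have cu : continuous u.
  move=> x; apply: cvgM; first exact: cvg_cst.
  by apply: cvgD; [exact: cvg_cst|exact: cpsi].
have u01 x : 0 <= u x <= 1.
  have := psiM x; rewrite ler_norml => /andP[h1 h2].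
  rewrite /u mulrC divr_ge0 ?ler_pdivrMr ?mulr_gt0//=; last 2 first.
  - by rewrite /N; lra.
  - by rewrite mulr_ge0// ltW.
  by rewrite /N; lra.
have -> : psi = (fun x => - N + 2 * N * u x).
  by apply/funext => x; rewrite /u mulVKf ?gt_eqF ?mulr_gt0//; lra.
clearbody u.
have bu := continuous_bounded cptX cu.
have bmu := continuous_bounded_measurable cptX cu.
rewrite LD ?LZ ?Lc//; last 2 first.
- exact: bounded_function_cst.
- exact: bounded_functionZ.
have bmc := @bounded_measurable_cst R _ (borel X) (- N).
by rewrite (meanD mu bmc (bounded_measurableZ _ bmu)) meanZ// mean_cst eq01.
Qed.

End WeakLimits.

(** * Existence of limit measures *)

Section LimitMeasures.
Context {R : realType} {X : pointedMetricType R}.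
Implicit Types (g psi : X -> R) (x : X) (O : set X).
Variable f : X -> X.
Hypothesis contf : continuous f.
Hypothesis cptX : compact [set: X].

Lemma ultrafilter_bounded_cvg (U : set_system nat) (a : nat -> R) (M : R) :
  UltraFilter U -> (forall n, `|a n| <= M) -> exists l : R, a n @[n --> U] --> l.
Proof.
move=> UF aM; have cptI : compact `[- M, M] by exact: segment_compact.
have [|l [_ lcl]] := cptI (a @ U) _.
  by apply: (@filterS _ U _ setT) => [n _|]; [rewrite /= in_itv/= -ler_norml|exact: filterT].
exists l => B nB; have [//|UnB] := in_ultra_setVsetC (a @^-1` B) UF.
by have [y []] := lcl (~` B) B UnB nB.
Qed.

Section Ultralimit.
Variables (x : X) (U : set_system nat).
Hypotheses (UF : UltraFilter U) (Uoo : \oo `<=` U).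

(** A limit of the orbit averages, for all bounded functions at once. *)
Definition ultra_mean g : R := lim (orbit_average f x n g @[n --> U]).

Lemma orbit_average_bounded g M n : (forall y, `|g y| <= M) ->
  `|orbit_average f x n g| <= M.
Proof.
move=> gM; have M0 : 0 <= M by apply: le_trans (gM x).
case: n => [|n]; first by rewrite /orbit_average invr0 mul0r normr0.
rewrite /orbit_average normrM ger0_norm ?invr_ge0// ler_pdivrMl ?ltr0n//.
rewrite (le_trans (ler_norm_sum _ _ _))// mulr_natl -[X in _ *+ X]card_ord -sumr_const.
by apply: ler_sum.
Qed.

Lemma ultra_mean_cvg g : bounded_function g ->
  orbit_average f x n g @[n --> U] --> ultra_mean g.
Proof.
move=> [M gM]; have [l al] := ultrafilter_bounded_cvg UF (fun n => orbit_average_bounded n gM).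
by apply/cvg_ex; exists l.
Qed.

Lemma ultra_mean_positive : positive_functional ultra_mean.
Proof.
split=> [g h bg bh|c g bg|g h bg bh gh].
- apply: cvg_lim => //.
  have -> : (fun n => orbit_average f x n (fun y => g y + h y)) =
      (fun n => orbit_average f x n g + orbit_average f x n h).
    by apply/funext => n; have [avgD _ _] := orbit_average_positive f x n; exact: avgD.
  by apply: cvgD; exact: ultra_mean_cvg.
- apply: cvg_lim => //.
  have -> : (fun n => orbit_average f x n (fun y => c * g y)) =
      (fun n => c * orbit_average f x n g).
    by apply/funext => n; have [_ avgZ _] := orbit_average_positive f x n; exact: avgZ.
  by apply: cvgMr; exact: ultra_mean_cvg.
- apply: (ler_cvg_to (ultra_mean_cvg bg) (ultra_mean_cvg bh)).
  by apply: nearW => n; have [_ _] := orbit_average_positive f x n; apply.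
Qed.

Lemma ultra_mean1 : ultra_mean (fun=> 1) = 1.
Proof.
apply: cvg_lim => //; apply: cvg_near_cst; apply: Uoo.
by exists 1%N => // n /= n0; exact: orbit_average1.
Qed.

(** The averages of [g \o f] and [g] differ by a boundary term of order 1/n. *)
Lemma ultra_mean_comp g : bounded_function g -> ultra_mean (g \o f) = ultra_mean g.
Proof.
move=> bg; have [M gM] := bg.
have bgf : bounded_function (g \o f) by exists M => y /=.
apply/eqP; rewrite -subr_eq0; apply/eqP.
have diff : (fun n => orbit_average f x n (g \o f) - orbit_average f x n g) @ U -->
    ultra_mean (g \o f) - ultra_mean g by apply: cvgB; exact: ultra_mean_cvg.
apply: (cvg_unique _ diff) => //.
apply: (cvg_trans (G := (fun n => n%:R^-1 * (g (iter n f x) - g x)) @ \oo)).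
  move=> B /Uoo UB; apply: (@filterS _ U _ _ _ _ UB) => n /=.
  by rewrite orbit_average_comp.
apply/cvgr0Pnorm_le => eps eps0.
have M0 : 0 <= M by apply: le_trans (gM x).
near=> n; rewrite normrM ger0_norm ?invr_ge0//.
have n0 : 0 < n%:R :> R by rewrite ltr0n; near: n; exact: nbhs_infty_gt.
rewrite ler_pdivrMl//; apply: (@le_trans _ _ (M + M)).
  by rewrite (le_trans (ler_normB _ _))// lerD.
rewrite -ler_pdivrMr//; near: n; exact: nbhs_infty_ger.
Unshelve. all: by end_near. Qed.

End Ultralimit.
Lemma positive_functional_close (L : (X -> R) -> R) g h eta :
  positive_functional L -> L (fun=> 1) = 1 ->
  bounded_function g -> bounded_function h -> (forall y, `|g y - h y| <= eta) ->
  `|L g - L h| <= eta.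
Proof.
move=> [LD LZ Lmon] L1 bg bh gh.
have Lc c : L (fun=> c) = c.
  rewrite -[RHS]mulr1 -L1 -LZ; last exact: bounded_function_cst.
  by congr L; apply/funext => y; rewrite mulr1.
have bc := @bounded_function_cst R X eta.
have half u v : bounded_function u -> bounded_function v ->
    (forall y, `|u y - v y| <= eta) -> L u - L v <= eta.
  move=> bu bv uv; rewrite lerBlDr -{1}(Lc eta) -LD//; apply: Lmon => //.
    exact: bounded_functionD.
  by move=> y; rewrite -lerBlDr (le_trans (ler_norm _)).
rewrite ler_norml half// andbT -lerN2 opprK opprB half// => y.
by rewrite distrC.
Qed.

Lemma finite_net r : 0 < r -> exists N (p : 'I_N.+1 -> X) (c : X -> 'I_N.+1),
  forall y, ball (p (c y)) r y.
Proof.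
move=> r0.
have : compact [set: X] by [].
rewrite compact_cover => /(_ X setT (fun q => (ball q r)°)) [||D _ Dcov].
- by move=> q _; exact: open_interior.
- by move=> y _; exists y => //; exact: nbhsx_ballx.
pose s : seq X := finmap.enum_fset D.
have sP y : exists i : 'I_(size s).+1, ball (nth y s i) r y /\ (i < size s)%N.
  have [q /= qD yq] := Dcov y I.
  have qs : (index q s < size s)%N by rewrite index_mem.
  exists (Ordinal (leqW qs)) => /=; split=> //.
  by rewrite nth_index; [exact: interior_subset yq|].
have /choice[c cP] := sP.
exists (size s), (fun i => nth point s i), c => y.
by have [+ lt] := cP y; rewrite (set_nth_default point).
Qed.

(** Compactness of the orbit averages.  The limit along an ultrafilter defines a
    content, hence a measure with the same means of continuous functions.  To find
    a sequence of times, only finitely many averages are matched at each stage,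
    those of the cells of a partition of small mesh; they control the average of
    any continuous function up to its oscillation on the cells. *)
Lemma limit_measures_nonempty x : exists mu, limit_measures f x mu.
Proof.
have [U [UF Uoo]] := @ultraFilterLemma nat \oo _.
pose L := ultra_mean x U.
have Lpos : positive_functional L := ultra_mean_positive x UF.
have L1 : L (fun=> 1) = 1 := ultra_mean1 x UF Uoo.
have [LD LZ Lmon] := Lpos.
have fap : finitely_additive_probability (fun A => L \1_A).
  split.
  - by rewrite -[RHS]L1; congr L; apply/funext => y; rewrite indicT.
  - move=> A; have := Lmon (fun=> 0 * 0) \1_A (bounded_function_cst _) (bounded_function_indic _).
    rewrite (LZ 0 (fun=> 0)) ?mul0r//; last exact: bounded_function_cst.
    by apply=> y; rewrite indicE.
  - move=> A B AB; rewrite -LD; [|exact: bounded_function_indic|exact: bounded_function_indic].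
    congr L; apply/funext => y; rewrite !indicE in_setU.
    case: (boolP (y \in A)) => yA; case: (boolP (y \in B)) => yB //=; rewrite ?addr0 ?add0r//.
    have : (A `&` B) y by split; exact: set_mem.
    by rewrite AB.
have [mu muL] := content_extension fap cptX.
have meanL : forall psi, continuous psi -> mean mu psi = L psi.
  apply: mean_of_open_domination => // W oW.
  by rewrite -lee_fin fineK ?muL// fin_num_measure//; exact: open_borel.
have inv : invariant_measure f mu.
  move=> A mA.
  pose F : {mfun borel X >-> borel X} := HB.pack (f : borel X -> borel X)
    (isMeasurableFun.Build _ _ _ _ _ (continuous_borel_fun contf)).
  change (distribution mu F A = mu A); apply: eq_mean_probability => // psi cpsi.
  have cpsif : continuous (psi \o f).
    by move=> y; apply: continuous_comp; [exact: contf|exact: cpsi].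
  rewrite [RHS]meanL// -[RHS](ultra_mean_comp x UF Uoo (continuous_bounded cptX cpsi)).
  rewrite -[RHS]meanL// /mean /Rintegral integral_distribution//.
    by apply/measurable_EFinP; case: (continuous_bounded_measurable cptX cpsi).
  have bpsif := continuous_bounded_measurable cptX cpsif.
  exact: (@bounded_measurable_integrable _ _ _ mu _ _ measurableT bpsif).
(* Stage [j] uses a partition into cells around the centres [p j], of radius
   1/(j+1); the tolerance makes the total error over the cells at most 1/(j+1). *)
have /choice[net netP] : forall j, exists N_p_c : {N & (('I_N.+1 -> X) * (X -> 'I_N.+1))%type},
    forall y, ball ((projT2 N_p_c).1 ((projT2 N_p_c).2 y)) j.+1%:R^-1 y.
  move=> j; have r0 : 0 < j.+1%:R^-1 :> R by rewrite invr_gt0.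
  by have [N [p [c pc]]] := finite_net r0; exists (existT _ N (p, c)).
pose N j := projT1 (net j); pose p j := (projT2 (net j)).1.
pose c j := (projT2 (net j)).2.
pose cell j i : set X := [set y | c j y = i].
pose tol j : R := (j.+1%:R * (N j).+1%:R)^-1.
have tol0 j : 0 < tol j by rewrite invr_gt0 mulr_gt0.
have /choice[n_ n_P] : forall j, exists n, (j < n)%N /\
    forall i, `|orbit_average f x n \1_(cell j i) - L \1_(cell j i)| <= tol j.
  move=> j; suff : U [set n | (j < n)%N /\
      forall i, `|orbit_average f x n \1_(cell j i) - L \1_(cell j i)| <= tol j].
    exact: filter_ex.
  apply: filterI; first by apply: Uoo; exact: nbhs_infty_gt.
  apply: filter_forall => i.
  have /cvgrPdist_le/(_ _ (tol0 j)) := ultra_mean_cvg (x := x) UF (@bounded_function_indic R X (cell j i)).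
  by apply: filterS => n; rewrite distrC.
exists mu; split=> //; exists n_; split.
  apply/cvgnyPge => m; exists m => // k /= mk.
  by apply: leq_trans mk _; have [/ltnW] := n_P k.
apply/(weak_star_orbit_average _ cptX) => psi cpsi.
have [M psiM] := continuous_bounded cptX cpsi.
rewrite meanL//; apply/cvgrPdist_le => eps eps0.
have eps30 : 0 < eps / 3 by rewrite divr_gt0.
have [r r0 psir] := uniform_continuity cptX cpsi eps30.
near=> k.
pose step y := \sum_i psi (p k i) * \1_(cell k i) y.
have bstep : bounded_function step.
  apply: bounded_function_sum => i; apply: bounded_functionZ; exact: bounded_function_indic.
have kr : k.+1%:R^-1 <= r.
  by apply: ltW; near: k; exact: near_infty_natSinv_lt (PosNum r0).
have psistep y : `|psi y - step y| <= eps / 3.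
  rewrite /step (bigD1 (c k y))//= big1 ?addr0 => [|i ic].
    rewrite indicE mem_set// mulr1 distrC; apply/ltW/psir.
    exact: le_ball (netP k y).
  by rewrite indicE memNset ?mulr0// => /esym/eqP; rewrite (negbTE ic).
have bpsi := continuous_bounded cptX cpsi.
have [kn nk] := n_P k.
have Apos := orbit_average_positive f x (n_ k).
have A1 := @orbit_average1 _ _ f x (n_ k) (leq_ltn_trans (leq0n _) kn).
have h1 := positive_functional_close Lpos L1 bpsi bstep psistep.
have h2 := positive_functional_close Apos A1 bpsi bstep psistep.
have h3 : `|L step - orbit_average f x (n_ k) step| <= eps / 3.
  have bterm i : bounded_function (fun y => psi (p k i) * \1_(cell k i) y).
    by apply: bounded_functionZ; exact: bounded_function_indic.
  rewrite !positive_functional_sum// -sumrB (le_trans (ler_norm_sum _ _ _))//.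
  apply: (@le_trans _ _ (\sum_(i < (N k).+1) M * tol k)).
    apply: ler_sum => i _; have [_ AZ _] := Apos.
    rewrite /= LZ ?AZ; [|exact: bounded_function_indic|exact: bounded_function_indic].
    by rewrite -mulrBr normrM ler_pM// distrC.
  rewrite sumr_const card_ord /tol -[leLHS]mulr_natl.
  have kM : M / (eps / 3) <= k%:R by near: k; exact: nbhs_infty_ger.
  rewrite [leLHS](_ : _ = M / k.+1%:R); last first.
    have scale (u v : R) : u != 0 -> v != 0 -> u * (M * (v * u)^-1) = M / v.
      by move=> u0 v0; field; rewrite u0 v0.
    by apply: scale; rewrite pnatr_eq0.
  rewrite ler_pdivrMr// mulrC -ler_pdivrMr//; apply: (le_trans kM).
  by rewrite ler_nat.
have -> : L psi - orbit_average f x (n_ k) psi = (L psi - L step) +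
   (L step - orbit_average f x (n_ k) step) -
   (orbit_average f x (n_ k) psi - orbit_average f x (n_ k) step) by ring.
rewrite (le_trans (ler_normB _ _))// (_ : eps = eps / 3 + eps / 3 + eps / 3); last by field.
by rewrite lerD// (le_trans (ler_normD _ _))// lerD.
Unshelve. all: by end_near. Qed.

End LimitMeasures.

(** * Gibbs' inequality and Fekete's lemma *)

Section RealAnalysis.
Context {R : realType}.

(** Here [b] is the length function of a code, the last hypothesis is Kraft's
    inequality, and the proof is that 1 + t <= exp t.  Only symbols of positive
    probability are counted, so that [b] may be minus the logarithm of a
    probability that vanishes somewhere. *)
Lemma gibbs (I : finType) (p b : I -> R) :
  (forall i, 0 <= p i) -> \sum_i p i = 1 ->
  \sum_(i | 0 < p i) expR (- b i) <= 1 ->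
  - \sum_i p i * ln (p i) <= \sum_i p i * b i.
Proof.
move=> p0 p1 kraft; rewrite -sumrN -subr_le0 -sumrB.
have pos (F : I -> R) : (forall i, p i = 0 -> F i = 0) ->
    \sum_i F i = \sum_(i | 0 < p i) F i.
  move=> F0; rewrite [LHS](bigID (fun i => 0 < p i))/= [X in _ + X]big1 ?addr0// => i.
  by rewrite lt_neqAle p0 andbT negbK => /eqP/esym/F0.
rewrite pos; last by move=> i ->; rewrite !mul0r oppr0 addr0.
apply: (@le_trans _ _ (\sum_(i | 0 < p i) (expR (- b i) - p i))).
  apply: ler_sum => i pi0.
  have h : 1 + (- ln (p i) - b i) <= (p i)^-1 * expR (- b i).
    by rewrite (le_trans (expR_ge1Dx _))// expRD expRN lnK// posrE.
  have := ler_wpM2l (ltW pi0) h; rewrite mulrA mulfV ?gt_eqF// mul1r.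
  by rewrite !mulrDr mulr1 !mulrN; lra.
by rewrite sumrB -(pos p)// p1 subr_le0.
Qed.

(** Fekete's lemma: the limit is the infimum, since a multiple of an almost
    optimal [m] can be reached from any [n] at bounded cost. *)
Lemma subadditive_is_cvg (a : nat -> R) : (forall n, 0 <= a n) ->
  (forall n k, a (n + k)%N <= a n + a k) -> cvgn (fun n => a n / n%:R).
Proof.
move=> a0 sub; pose S := [set a n.+1 / n.+1%:R | n in [set: nat]].
have lS : lbound S 0 by move=> _ [n _ <-]; rewrite divr_ge0.
have hS : has_inf S by split; [exists (a 1%N / 1%:R), 0%N|exists 0].
apply/cvg_ex; exists (inf S); apply/cvgrPdist_le => eps eps0.
have eps20 : 0 < eps / 2 by rewrite divr_gt0.
have [_ [m _ <-] am] := inf_adherent eps20 hS.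
have mulm q s : a (q * m.+1 + s)%N <= q%:R * a m.+1 + a s.
  elim: q => [|q IH]; first by rewrite mul0n add0n mul0r add0r.
  rewrite mulSn -addnA (le_trans (sub _ _))// -natr1 mulrDl mul1r.
  by move: IH; lra.
pose C := \sum_(i < m.+1) a i.
near=> n.
have n0 : (0 < n)%N by near: n; exact: nbhs_infty_gt.
have n0' : 0 < n%:R :> R by rewrite ltr0n.
have lower : inf S <= a n / n%:R.
  by apply: ge_inf; [exists 0|exists n.-1 => //; rewrite prednK].
rewrite distrC ger0_norm ?subr_ge0// lerBlDl.
have Cn : C / n%:R <= eps / 2.
  by rewrite ler_pdivrMr// mulrC -ler_pdivrMr//; near: n; exact: nbhs_infty_ger.
have upper : a n <= (n %/ m.+1)%:R * a m.+1 + C.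
  rewrite {1}(divn_eq n m.+1) (le_trans (mulm _ _))// lerD2l /C.
  have ltm : (n %% m.+1 < m.+1)%N by rewrite ltn_mod.
  by rewrite (bigD1 (Ordinal ltm))//= lerDl sumr_ge0.
have mid : (n %/ m.+1)%:R * a m.+1 / n%:R <= a m.+1 / m.+1%:R.
  rewrite ler_pdivrMr// mulrAC ler_pdivlMr// -!mulrA mulrC -mulrA ler_wpM2l//.
  by rewrite -natrM ler_nat mulnC leq_trunc_div.
apply: (@le_trans _ _ ((n %/ m.+1)%:R * a m.+1 / n%:R + C / n%:R)).
  by rewrite -mulrDl ler_pM2r ?invr_gt0.
by rewrite [eps]splitr addrA lerD// (le_trans mid)// ltW.
Unshelve. all: by end_near. Qed.

End RealAnalysis.

(** * Functions of a finite-valued map *)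

Section FiniteValued.
Context {R : realType} {d : measure_display} {T : measurableType d}.
Variables (I : finType) (t : T -> I) (mu : probability T R).
Hypothesis mt : forall i, measurable [set y | t y = i].
Implicit Types F : I -> R.

Let finite_valuedE F :
  (fun y => F (t y)) = (fun y => \sum_i F i * \1_[set y | t y = i] y).
Proof.
apply/funext => y; rewrite (bigD1 (t y))//= big1 ?addr0 => [|i ity].
  by rewrite indicE mem_set// mulr1.
by rewrite indicE memNset ?mulr0// => /esym/eqP; rewrite (negbTE ity).
Qed.

Lemma bounded_measurable_finite_valued F : bounded_measurable (fun y => F (t y)).
Proof.
rewrite finite_valuedE; apply: bounded_measurable_sum => i.
by apply: bounded_measurableZ; exact: bounded_measurable_indic.
Qed.

Lemma mean_finite_valued F :
  mean mu (fun y => F (t y)) = \sum_i fine (mu [set y | t y = i]) * F i.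
Proof.
rewrite finite_valuedE mean_sum => [|i]; last first.
  by apply: bounded_measurableZ; exact: bounded_measurable_indic.
apply: eq_bigr => i _; rewrite meanZ; last exact: bounded_measurable_indic.
by rewrite mean_indic// mulrC.
Qed.

Lemma sum_finite_valued : \sum_i fine (mu [set y | t y = i]) = 1.
Proof.
rewrite -[RHS](mean_cst mu) -[RHS]/(mean mu (fun y => (fun=> 1) (t y))) mean_finite_valued.
by apply: eq_bigr => i _; rewrite mulr1.
Qed.

End FiniteValued.

(** * Itineraries and their entropy *)

Section Itineraries.
Context {R : realType} {X : pointedMetricType R}.
Variables (f : X -> X) (mu : probability (borel X) R) (r : nat).
Variables (A : 'I_r -> set (borel X)) (c : X -> 'I_r).
Hypotheses (mf : measurable_fun [set: borel X] (f : borel X -> borel X))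
  (inv : invariant_measure f mu) (mA : forall i, measurable (A i))
  (cP : forall y i, A i y <-> c y = i).

Definition itinerary n (y : X) : {ffun 'I_n -> 'I_r} := [ffun k : 'I_n => c (iter k f y)].

Lemma join_cell_itinerary n (w : {ffun 'I_n -> 'I_r}) :
  join_cell f A w = [set y | itinerary n y = w].
Proof.
apply/seteqP; split=> y /=.
  by move=> yw; apply/ffunP => k; rewrite ffunE; apply/cP/yw.
by move=> <- k _; rewrite /= ffunE; apply/cP.
Qed.

Lemma measurable_iter n : measurable_fun [set: borel X] (iter n f : borel X -> borel X).
Proof.
elim: n => [|n IH]; first exact: measurable_id.
exact: (measurableT_comp mf IH).
Qed.

Lemma measurable_itinerary n (w : {ffun 'I_n -> 'I_r}) :
  measurable ([set y | itinerary n y = w] : set (borel X)).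
Proof.
rewrite -join_cell_itinerary; apply: fin_bigcap_measurable => // k _.
by rewrite -[X in measurable X]setTI; apply: measurable_iter.
Qed.

Definition word_prob n (w : {ffun 'I_n -> 'I_r}) : R := fine (mu (join_cell f A w)).

Lemma word_prob_ge0 n (w : {ffun 'I_n -> 'I_r}) : 0 <= word_prob w.
Proof. by rewrite fine_ge0. Qed.

Lemma mean_itinerary n (F : {ffun 'I_n -> 'I_r} -> R) :
  mean mu (fun y => F (itinerary n y)) = \sum_w word_prob w * F w.
Proof.
rewrite mean_finite_valued; last exact: measurable_itinerary.
by apply: eq_bigr => w _; rewrite /word_prob join_cell_itinerary.
Qed.

Lemma bounded_measurable_itinerary n (F : {ffun 'I_n -> 'I_r} -> R) :
  @bounded_measurable R _ (borel X) (fun y => F (itinerary n y)).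
Proof. exact: bounded_measurable_finite_valued (measurable_itinerary (n := n)) F. Qed.

Lemma sum_word_prob n : \sum_(w : {ffun 'I_n -> 'I_r}) word_prob w = 1.
Proof.
rewrite -[RHS](sum_finite_valued mu (measurable_itinerary (n := n))).
by apply: eq_bigr => w _; rewrite /word_prob join_cell_itinerary.
Qed.

Lemma word_prob_le1 n (w : {ffun 'I_n -> 'I_r}) : word_prob w <= 1.
Proof.
rewrite -(sum_word_prob n) (bigD1 w)//= lerDl sumr_ge0// => v _.
exact: word_prob_ge0.
Qed.

Lemma join_entropy_le_code n (b : {ffun 'I_n -> 'I_r} -> R) :
  \sum_(w | 0 < word_prob w) expR (- b w) <= 1 ->
  join_entropy f mu A n <= mean mu (fun y => b (itinerary n y)).
Proof.
move=> kraft; rewrite mean_itinerary.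
by apply: gibbs => // [w|]; [exact: word_prob_ge0|exact: sum_word_prob].
Qed.

Lemma join_entropy_mean n : join_entropy f mu A n =
  mean mu (fun y => - ln (word_prob (itinerary n y))).
Proof.
rewrite (mean_itinerary (fun w => - ln (word_prob w))) /join_entropy -sumrN.
by apply: eq_bigr => w _; rewrite mulrN.
Qed.

Lemma join_entropy_ge0 n : 0 <= join_entropy f mu A n.
Proof.
rewrite join_entropy_mean; apply: mean_ge0; first exact: (bounded_measurable_itinerary (fun w => - ln (word_prob w))).
move=> y; rewrite oppr_ge0; apply: ln_le0; exact: word_prob_le1.
Qed.

Definition front n k (w : {ffun 'I_(n + k) -> 'I_r}) : {ffun 'I_n -> 'I_r} :=
  [ffun i => w (lshift k i)].
Definition back n k (w : {ffun 'I_(n + k) -> 'I_r}) : {ffun 'I_k -> 'I_r} :=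
  [ffun i => w (rshift n i)].

Lemma sum_front_back n k (P : {ffun 'I_n -> 'I_r} -> R) (Q : {ffun 'I_k -> 'I_r} -> R) :
  \sum_w P (front w) * Q (back w) = (\sum_u P u) * (\sum_v Q v).
Proof.
rewrite big_distrlr/= pair_big/=.
rewrite (reindex (fun w : {ffun 'I_(n + k) -> 'I_r} => (front w, back w)))//=.
exists (fun uv : {ffun 'I_n -> 'I_r} * {ffun 'I_k -> 'I_r} =>
  [ffun i : 'I_(n + k) => match fintype.split i with inl j => uv.1 j | inr j => uv.2 j end]).
  by move=> w _; apply/ffunP => i; rewrite ffunE; case: split_ordP => j ->; rewrite ffunE.
move=> [u v] _; congr pair; apply/ffunP => i; rewrite !ffunE.
  by rewrite (unsplitK (inl i)).
by rewrite (unsplitK (inr i)).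
Qed.

Lemma front_itinerary n k y : front (itinerary (n + k) y) = itinerary n y.
Proof. by apply/ffunP => i; rewrite !ffunE. Qed.

Lemma back_itinerary n k y : back (itinerary (n + k) y) = itinerary k (iter n f y).
Proof. by apply/ffunP => i; rewrite !ffunE /= addnC iterD. Qed.

Lemma iter_invariant n : forall B : set (borel X), measurable B ->
  mu (iter n f @^-1` B) = mu B.
Proof.
elim: n => [//|n IH] B mB.
have -> : iter n.+1 f @^-1` B = iter n f @^-1` (f @^-1` B) by [].
by rewrite IH ?inv// -[X in measurable X]setTI; exact: mf.
Qed.

(** Coding the two halves of a word separately is no better than coding the word,
    and by invariance the second half costs as much as an initial word. *)
Lemma join_entropy_subadditive n k :
  join_entropy f mu A (n + k) <= join_entropy f mu A n + join_entropy f mu A k.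
Proof.
pose b (w : {ffun 'I_(n + k) -> 'I_r}) := - ln (word_prob (front w)) - ln (word_prob (back w)).
have mono (w : {ffun 'I_(n + k) -> 'I_r}) : word_prob w <= word_prob (front w)
    /\ word_prob w <= word_prob (back w).
  have mj m (v : {ffun 'I_m -> 'I_r}) : measurable (join_cell f A v).
    by rewrite join_cell_itinerary; exact: measurable_itinerary.
  have mi : measurable (iter n f @^-1` join_cell f A (back w) : set (borel X)).
    by rewrite -[X in measurable X]setTI; apply: measurable_iter.
  split.
    apply: le_fine_measure => //; rewrite !join_cell_itinerary => y /= <-.
    exact/esym/front_itinerary.
  have -> : word_prob (back w) = fine (mu (iter n f @^-1` join_cell f A (back w))).
    by congr fine; exact/esym/iter_invariant.
  apply: le_fine_measure => //; rewrite !join_cell_itinerary => y /= <-.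
  exact/esym/back_itinerary.
apply: (@le_trans _ _ (mean mu (fun y => b (itinerary (n + k) y)))).
  apply: join_entropy_le_code; rewrite -[leRHS]mulr1 -{1}(sum_word_prob n) -(sum_word_prob k).
  rewrite -sum_front_back big_mkcond/=; apply: ler_sum => w _; case: ifPn => [w0|_].
    have [m1 m2] := mono w.
    have p1 := lt_le_trans w0 m1; have p2 := lt_le_trans w0 m2.
    by rewrite /b opprB opprK expRD !lnK ?posrE// mulrC.
  by rewrite mulr_ge0// word_prob_ge0.
have bn m := bounded_measurable_itinerary (n := m) (fun w => - ln (word_prob w)).
have bk := bounded_measurable_comp (measurable_iter n) (bn k).
rewrite !join_entropy_mean -(mean_comp (measurable_iter n) (iter_invariant n) (bn k)).
rewrite -(meanD mu (bn n) bk) le_eqVlt; apply/orP; left; apply/eqP; congr mean.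
by apply/funext => y; rewrite /b front_itinerary back_itinerary.
Qed.

Lemma entropy_wrt_cvg :
  join_entropy f mu A n / n%:R @[n --> \oo] --> entropy_wrt f mu A.
Proof.
apply: subadditive_is_cvg; [exact: join_entropy_ge0|exact: join_entropy_subadditive].
Qed.

End Itineraries.

Lemma finite_partition_label {R : realType} {X : pointedMetricType R} (r : nat)
    (A : 'I_r -> set (borel X)) : finite_partition A ->
  exists c : X -> 'I_r, forall y i, A i y <-> c y = i.
Proof.
move=> [mA tA UA].
have /choice[c cP] : forall y : X, exists i, A i y.
  by move=> y; have [i _ Aiy] : (\bigcup_i A i) y; [by rewrite UA|exists i].
exists c => y i; split=> [Aiy|<-//].
by apply: (tA _ _ I I); exists y.
Qed.

(** * Inner regularity by closed sets *)

Section Regularity.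
Context {R : realType} {X : pointedMetricType R}.
Variable mu : probability (borel X) R.

Let sandwiched (A : set X) := forall eps, 0 < eps -> exists C W : set X,
  [/\ closed C, open W, C `<=` A, A `<=` W & (mu (W `\` C) <= eps%:E)%E].

Let openD_borel (W C : set X) : open W -> closed C -> measurable (W `\` C : set (borel X)).
Proof.
move=> oW cC; apply: open_borel; rewrite setDE; apply: openI => //.
exact: closed_openC.
Qed.

Let sandwiched_open W : open W -> sandwiched W.
Proof.
move=> oW eps eps0; have [e e0 muW] := erosion_measure_approx mu oW eps0.
have mW := open_borel oW.
have me : measurable (erosion e W : set (borel X)) by apply: closed_borel; exact: closed_erosion.
exists (erosion e W), W; split=> //; [exact: closed_erosion|exact: erosion_sub|].
rewrite measureD//; last by rewrite -ge0_fin_numE// fin_num_measure.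
rewrite setIC setIidl; last exact: erosion_sub.
rewrite -(fineK (fin_num_measure mu _ mW)) -(fineK (fin_num_measure mu _ me)).
by rewrite -EFinB lee_fin lerBlDl.
Qed.

Let sandwiched_setC A : sandwiched A -> sandwiched (~` A).
Proof.
move=> sA eps /sA[C [W [cC oW CA AW muWC]]].
exists (~` W), (~` C); split.
- exact: open_closedC.
- exact: closed_openC.
- exact: subsetC.
- exact: subsetC.
- by rewrite setDE setCK setIC -setDE.
Qed.

Let sandwiched_bigcup (A : nat -> set X) :
  (forall n, sandwiched (A n)) -> sandwiched (\bigcup_n A n).
Proof.
move=> sA eps eps0; have eps20 : 0 < eps / 2 by rewrite divr_gt0.
have /choice[CW CWP] : forall n, exists CW : set X * set X,
    [/\ closed CW.1, open CW.2, CW.1 `<=` A n, A n `<=` CW.2 &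
      (mu (CW.2 `\` CW.1) <= (eps / 2 / (2 ^ n.+1)%:R)%:E)%E].
  move=> n; have e0 : 0 < eps / 2 / (2 ^ n.+1)%:R by rewrite divr_gt0// ltr0n expn_gt0.
  by have [C [W CWn]] := sA n _ e0; exists (C, W).
pose C n := (CW n).1; pose W n := (CW n).2.
have cC n : closed (C n) by have [] := CWP n.
have oW n : open (W n) by have [] := CWP n.
have mC n : measurable (C n : set (borel X)) by exact: closed_borel.
pose D n : set (borel X) := \big[setU/set0]_(i < n) C i.
have mD n : measurable (D n) by exact: bigsetU_measurable.
have mUC : measurable (\bigcup_n C n : set (borel X)) by exact: bigcup_measurable.
have cvD : mu (D n) @[n --> \oo] --> mu (\bigcup_n D n).
  apply: nondecreasing_cvg_mu => //.
    exact: bigcup_measurable.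
  by move=> n m nm; apply/subsetPset; exact: subset_bigsetU.
have UDC : \bigcup_n D n = \bigcup_n C n.
  apply/seteqP; split=> x [i _].
    by rewrite /D -bigcup_mkord => -[j _ Cjx]; exists j.
  by move=> Cix; exists i.+1 => //; rewrite /D -bigcup_mkord; exists i => /=.
have [n nP] : exists n, fine (mu (\bigcup_n C n)) <= fine (mu (D n)) + eps / 2.
  move: cvD; rewrite UDC -[X in _ --> X]fineK ?fin_num_measure// => /fine_cvgP[_].
  move=> /cvgrPdist_le/(_ _ eps20)[n _ nP]; exists n; rewrite -lerBlDl.
  exact: le_trans (ler_norm _) (nP n (leqnn n)).
exists (D n), (\bigcup_n W n); split.
- by rewrite /D; elim/big_ind : _ => //; [exact: closed0|exact: closedU].
- exact: bigcup_open.
- move=> x; rewrite /D -bigcup_mkord => -[i _ Cix]; exists i => //.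
  by have [_ _ + _ _] := CWP i; apply.
- by move=> x [i _ Aix]; exists i => //; have [_ _ _ + _] := CWP i; apply.
have mWC : measurable (\bigcup_n (W n `\` C n) : set (borel X)).
  by apply: bigcup_measurable => i _; exact: openD_borel.
have mCD : measurable ((\bigcup_n C n) `\` D n : set (borel X)) by exact: measurableD.
apply: (@le_trans _ _ (mu (\bigcup_n (W n `\` C n) `|` ((\bigcup_n C n) `\` D n)))).
  rewrite le_measure ?inE//.
  - by apply: measurableD => //; apply: bigcup_measurable => i _; exact: open_borel.
  - exact: measurableU.
  move=> x [[i _ Wix] nDx]; have [Cix|nCix] := pselect (C i x).
    by right; split => //; exists i.
  by left; exists i.
apply: (le_trans (measureU2 _ mWC mCD)); rewrite [eps in leRHS]splitr EFinD; apply: leeD.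
  apply: (@le_trans _ _ (\sum_(0 <= i <oo) mu (W i `\` C i))%E).
    by apply: measure_sigma_subadditive => // i; exact: openD_borel.
  apply: le_trans (epsilon_trick0 xpredT (ltW eps20)).
  by apply: lee_nneseries => // i _; have [] := CWP i.
rewrite measureD//; last by rewrite -ge0_fin_numE// fin_num_measure.
rewrite setIC setIidl; last by move=> x Dx; rewrite -UDC; exists n.
rewrite -(fineK (fin_num_measure mu _ mUC)) -(fineK (fin_num_measure mu _ (mD n))).
by rewrite -EFinB lee_fin lerBlDl.
Qed.

(** The sets squeezed between a closed and an open set of almost the same measure
    form a sigma-algebra that contains the open sets. *)
Lemma closed_inner_regular (A : set (borel X)) : measurable A ->
  forall eps, 0 < eps -> exists C : set X,
  [/\ closed C, C `<=` A & fine (mu (A `\` C)) <= eps].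
Proof.
move=> mA eps eps0; have sA : sandwiched A.
  move: A mA; apply: smallest_sub; last by move=> W; exact: sandwiched_open.
  split=> [|A sA|A sA].
  - exact/sandwiched_open/open0.
  - by rewrite setTD; exact: sandwiched_setC.
  - exact: sandwiched_bigcup.
have [C [W [cC oW CA AW muWC]]] := sA _ eps0.
have mC := closed_borel cC.
exists C; split=> //; rewrite -lee_fin fineK; last by apply: fin_num_measure; exact: measurableD.
apply: le_trans muWC; rewrite le_measure ?inE//.
- exact: measurableD.
- exact: openD_borel.
- exact: setSD.
Qed.

End Regularity.

(** * Separation of disjoint closed sets *)

Section Separation.
Context {R : realType} {X : pointedMetricType R}.

(** Near a point, only the sets that contain it are seen, and there is at most
    one of them. *)
Lemma closed_disjoint_separated (r : nat) (B : 'I_r -> set X) :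
  compact [set: X] -> (forall i, closed (B i)) ->
  (forall i j x, B i x -> B j x -> i = j) ->
  exists2 e : R, 0 < e & forall z i j u v,
    B i u -> B j v -> ball z e u -> ball z e v -> i = j.
Proof.
move=> cptX cB dB.
have [|e e0 eP] := @compact_uniformly R X cptX (fun e z => forall i j u v,
    B i u -> B j v -> ball z e u -> ball z e v -> i = j).
  move=> x.
  have : \forall s \near (0 : R)^'+, forall i, B i x \/ ball x s `&` B i = set0.
    apply: filter_forall => i; have [Bix|nBix] := pselect (B i x).
      by near=> s; left.
    have : open (~` B i) by exact: closed_openC.
    rewrite openE => /(_ _ nBix); rewrite /interior -nbhs_ballE => -[t /= t0 tB].
    near=> s; right; apply/seteqP; split=> // y [xy Biy]; apply: (tB y) => //.
    by apply: le_ball xy; near: s; exact: nbhs_right_le.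
  move=> /filterI/(_ (nbhs_right_gt 0))/filter_ex[s [sP s0]].
  exists (s / 2); first by rewrite divr_gt0.
  move=> z e xz /andP[e0 es] i j u v Biu Bjv zu zv.
  have near_x k w : B k w -> ball z e w -> B k x.
    move=> Bkw zw; have [//|/seteqP[+ _]] := sP k.
    move=> /(_ w) []; split=> //; rewrite [s]splitr.
    by apply: (ball_triangle xz); apply: le_ball zw; exact: ltW.
  by apply: (dB i j x); [exact: near_x zu|exact: near_x zv].
exists (e / 2); first by rewrite divr_gt0.
move=> z; apply: eP; rewrite divr_gt0//= ltr_pdivrMr// ltr_pMr// ltr1n//.
Unshelve. all: by end_near. Qed.

End Separation.

(** * Coding orbits by a spanning set *)

Section SpanningCode.
Context {R : realType} {X : pointedMetricType R}.
Variables (f : X -> X) (phi : X -> R) (mu : probability (borel X) R) (r : nat).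
Variables (A : 'I_r -> set (borel X)) (c : X -> 'I_r) (B : 'I_r -> set X) (Y : set X).
Variables (e1 c0 c1 gam : R).
Hypotheses (mf : measurable_fun [set: borel X] (f : borel X -> borel X))
  (inv : invariant_measure f mu) (mA : forall i, measurable (A i))
  (cP : forall y i, A i y <-> c y = i).
Hypotheses (bphi : @bounded_measurable R _ (borel X) phi)
  (cB : forall i, closed (B i)) (BA : forall i, B i `<=` A i)
  (sepB : forall z i j u v, B i u -> B j v -> ball z e1 u -> ball z e1 v -> i = j).
Hypotheses (mY : measurable (Y : set (borel X))) (muY : mu Y = 1%E).
Hypotheses (c0_ge0 : 0 <= c0) (c1_ge0 : 0 <= c1)
  (kraft : expR (- c0) + r%:R * expR (- c1) <= 1)
  (osc : forall x y, ball x e1 y -> phi x <= phi y + gam).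

Let bad : set (borel X) := ~` \bigcup_i B i.

Let mbad : measurable bad.
Proof.
apply: measurableC; apply: fin_bigcup_measurable => // i _; exact: closed_borel.
Qed.

(** Well defined where it matters, because no [e1]-ball meets two of the closed
    sets; elsewhere the symbol is arbitrary. *)
Definition guess (z : X) : 'I_r :=
  odflt (c point) [pick i | `[< exists2 u, B i u & ball z e1 u >] ].

Lemma guessE z i u : B i u -> ball z e1 u -> guess z = i.
Proof.
move=> Biu zu; rewrite /guess; case: pickP => [j /asboolP[v Bjv zv]|/(_ i)] /=.
  exact: (sepB Bjv Biu zv zu).
by move/asboolP => []; exists u.
Qed.

Let cost (j g : 'I_r) : R := if j == g then c0 else c1.

Let sum_cost g : \sum_j expR (- cost j g) <= 1.
Proof.
apply: le_trans kraft; rewrite (bigD1 g)//= {1}/cost eqxx lerD2l.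
apply: (@le_trans _ _ (\sum_(j < r) expR (- c1))).
  rewrite [leRHS](bigD1 g)//= ler_wpDl ?expR_ge0// ler_sum// => j jg.
  by rewrite /cost (negbTE jg).
by rewrite sumr_const card_ord mulr_natl.
Qed.

Let cost_le x z : ball x e1 z -> cost (c x) (guess z) <= c0 + c1 * \1_bad x.
Proof.
move=> xz; have [[i _ Bix]|nBx] := pselect ((\bigcup_i B i) x).
  rewrite (guessE Bix (ball_sym xz)) /cost (_ : c x = i); last exact/cP/BA.
  by rewrite eqxx lerDl mulr_ge0.
by rewrite indicE mem_set//= mulr1 /cost; case: ifP => _; rewrite ?lerDl ?lerDr.
Qed.

Let wordcost n (w : {ffun 'I_n -> 'I_r}) (y : X) : R :=
  \sum_(t < n) cost (w t) (guess (iter t f y)).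

Let sum_wordcost n y : \sum_(w : {ffun 'I_n -> 'I_r}) expR (- wordcost w y) <= 1.
Proof.
under eq_bigr do rewrite -sumrN expR_sum.
rewrite -(bigA_distr_bigA (fun (t : 'I_n) j => expR (- cost j (guess (iter t f y)))))/=.
apply: prodr_ile1 => t _; rewrite sum_cost andbT sumr_ge0// => j _; exact: expR_ge0.
Qed.

(** The itinerary of [x] is coded by a shadowing point [y] of the spanning set and
    by the symbols to be used instead of those guessed from the orbit of [y].
    Weighting [y] by exp (S_n phi y) makes the first part cost
    ln (sum of the weights) - S_n phi y; each symbol costs [c0] if the guess is
    right and [c1] otherwise, which happens on [bad] only. *)
Lemma join_entropy_le_spanning n (s : seq X) :
  (forall x, Y x -> exists2 y, y \in s & forall i, (i < n)%N ->
     ball (iter i f x) e1 (iter i f y)) ->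
  join_entropy f mu A n + n%:R * mean mu phi <=
    ln (\sum_(y <- s) expR (birkhoff_sum f phi n y)) +
    n%:R * (gam + c0 + c1 * fine (mu bad)).
Proof.
move=> span; pose S := \sum_(y <- s) expR (birkhoff_sum f phi n y).
have [x0 Yx0] : exists x, Y x.
  apply/not_existsP => nY; have Y0 : Y = set0 by apply/seteqP; split=> // x /nY.
  by move: muY; rewrite Y0 measure0 => /eqP; rewrite eq_sym onee_eq0.
have term_le (F : X -> R) y : (forall y, 0 < F y) -> y \in s -> F y <= \sum_(z <- s) F z.
  move=> F0 ys; rewrite (big_rem y)//= lerDl big_seq_cond sumr_ge0// => z _.
  exact: ltW.
have S0 : 0 < S.
  have [y ys _] := span _ Yx0.
  by apply: lt_le_trans (term_le _ _ _ ys) => // *; exact: expR_gt0.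
pose Q (w : {ffun 'I_n -> 'I_r}) :=
  \sum_(y <- s) expR (birkhoff_sum f phi n y - wordcost w y).
have Q0 w : 0 < Q w.
  have [y ys _] := span _ Yx0.
  by apply: lt_le_trans (term_le _ _ _ ys) => // *; exact: expR_gt0.
pose b w := ln S - ln (Q w).
have codeb : \sum_(w | 0 < word_prob f mu A w) expR (- b w) <= 1.
  apply: (@le_trans _ _ (\sum_w S^-1 * Q w)).
    rewrite big_mkcond ler_sum// => w _; case: ifP => _.
      by rewrite /b opprB expRB !lnK ?posrE// mulrC.
    by rewrite mulr_ge0 ?invr_ge0 ?ltW.
  rewrite -mulr_sumr ler_pdivrMl// mulr1 exchange_big/= ler_sum// => y _.
  under eq_bigr do rewrite expRD.
  by rewrite -mulr_sumr ler_piMr ?expR_ge0// sum_wordcost.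
pose corr (x : X) := gam + c0 + c1 * \1_bad x.
have bcorr : @bounded_measurable R _ (borel X) corr.
  apply: bounded_measurableD; first exact: bounded_measurable_cst.
  by apply: bounded_measurableZ; exact: bounded_measurable_indic.
have mi k := measurable_iter mf k.
have bphik k : @bounded_measurable R _ (borel X) (fun x => phi (iter k f x)).
  exact: bounded_measurable_comp (mi k) bphi.
have bcorrk k : @bounded_measurable R _ (borel X) (fun x => corr (iter k f x)).
  exact: bounded_measurable_comp (mi k) bcorr.
pose rhs x := ln S + \sum_(k < n) (corr (iter k f x) + -1 * phi (iter k f x)).
have bterm (k : 'I_n) : @bounded_measurable R _ (borel X)
    (fun x => corr (iter k f x) + -1 * phi (iter k f x)).
  by apply: bounded_measurableD => //; exact: bounded_measurableZ.
have bsum : @bounded_measurable R _ (borel X)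
    (fun x => \sum_(k < n) (corr (iter k f x) + -1 * phi (iter k f x))).
  exact: bounded_measurable_sum.
have bcS := @bounded_measurable_cst R _ (borel X) (ln S).
have brhs : @bounded_measurable R _ (borel X) rhs by exact: bounded_measurableD.
have bb := bounded_measurable_itinerary mf mA cP b.
(* The code length is a mixture over all of the spanning set; one shadowing
   point bounds it, and no measurable choice of that point is made. *)
have pointwise x : Y x -> b (itinerary f c n x) <= rhs x.
  move=> Yx; have [y ys xy] := span _ Yx.
  have le1 : birkhoff_sum f phi n y - wordcost (itinerary f c n x) y <= ln (Q (itinerary f c n x)).
    rewrite -[leLHS]expRK ler_ln ?posrE ?expR_gt0//.
    by apply: (term_le (fun y => expR (birkhoff_sum f phi n y - wordcost _ y))) => // *; exact: expR_gt0.
  rewrite /b /rhs lerD2l lerNl; apply: le_trans le1.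
  rewrite /birkhoff_sum /wordcost -sumrB -sumrN ler_sum// => k _.
  rewrite ffunE; have xyk := xy k (ltn_ord k).
  have := cost_le xyk; have := osc xyk; rewrite /corr; lra.
have := join_entropy_le_code mf mA cP codeb.
move=> /le_trans/(_ (ae_le_mean mY muY bb brhs pointwise)).
rewrite (meanD mu bcS bsum) mean_cst mean_sum//.
rewrite (eq_bigr (fun=> gam + c0 + c1 * fine (mu bad) - mean mu phi)); last first.
  move=> k _; rewrite (meanD mu (bcorrk k) (bounded_measurableZ (-1) (bphik k))).
  rewrite meanZ// (mean_comp (mi k) (iter_invariant mf inv k) bcorr).
  rewrite (mean_comp (mi k) (iter_invariant mf inv k) bphi) mulN1r.
  have bi := @bounded_measurable_indic R _ _ _ mbad.
  rewrite (meanD mu (bounded_measurable_cst (gam + c0)) (bounded_measurableZ c1 bi)).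
  by rewrite mean_cst meanZ// (mean_indic mu mbad).
rewrite sumr_const card_ord -[X in _ <= _ + X]mulr_natl -/S; lra.
Qed.

End SpanningCode.

(** * Limits superior *)

Section LimitSuperior.
Context {R : realType}.
Implicit Types (u v : nat -> \bar R).
Local Open Scope ereal_scope.

Lemma limn_esup_ge u l : (\forall n \near \oo, l <= u n) -> l <= limn_esup u.
Proof.
move=> lu; rewrite /limn_esup limf_esupE; apply: le_ereal_inf_tmp => _ [V oV <-].
have [n [Vn ln]] := filter_ex (filterI oV lu).
by apply: le_ereal_sup_tmp; exists (u n) => //; exists n.
Qed.

Lemma le_limn_esup u v : (forall n, u n <= v n) -> limn_esup u <= limn_esup v.
Proof.
move=> uv; rewrite /limn_esup !limf_esupE; apply: le_ereal_inf_tmp => _ [V oV <-].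
apply: (@le_trans _ _ (ereal_sup (u @` V))).
  by apply: ereal_inf_lbound; exists V.
apply: ge_ereal_sup => _ [n Vn <-].
by apply: le_ereal_sup_tmp; exists (v n) => //; exists n.
Qed.

End LimitSuperior.

(** * Free energy and classical pressure *)

Section UpperBound.
Context {R : realType} {X : pointedMetricType R}.
Variables (f : X -> X) (phi : X -> R).
Hypotheses (cptX : compact [set: X]) (contf : continuous f) (contphi : continuous phi).
Implicit Types (mu : probability (borel X) R) (Y : set X).

(** Portmanteau for the complement of a closed set that the orbit never leaves. *)
Lemma limit_measure_support x mu Y : limit_measures f x mu -> closed Y ->
  (forall n, Y (iter n f x)) -> mu Y = 1%E.
Proof.
move=> [_ [n_ [_ /(weak_star_orbit_average _ cptX) cv]]] cY orbY.
have oY : open (~` Y) by exact: closed_openC.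
have mY := closed_borel cY.
have := probability_setC mu mY.
have -> : mu (~` Y) = 0%E.
  rewrite -(fineK (fin_num_measure mu _ (open_borel oY))); congr _%:E.
  apply/eqP; rewrite eq_le fine_ge0// andbT; apply/ler_addgt0Pr => eta eta0.
  have /filter_ex[k] := portmanteau_open cptX cv oY eta0.
  rewrite /orbit_average /birkhoff_sum big1 ?mulr0// => i _.
  by rewrite indicE memNset//= => nY; apply: nY; exact: orbY.
rewrite -(fineK (fin_num_measure mu _ mY)) -EFinB => -[/eqP].
by rewrite eq_sym subr_eq0 => /eqP <-.
Qed.

(** Kraft's inequality for the corrections: right guesses may be almost free if
    wrong ones are expensive enough. *)
Lemma expR_code_lengths (r : nat) (eps : R) : 0 < eps -> (0 < r)%N ->
  exists2 c1, 0 <= c1 & expR (- eps) + r%:R * expR (- c1) <= 1.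
Proof.
move=> eps0 r0; pose q := (1 - expR (- eps)) / r%:R.
have r0' : 0 < r%:R :> R by rewrite ltr0n.
have e1 : expR (- eps) < 1 by rewrite -expR0 ltr_expR oppr_lt0.
have q0 : 0 < q by rewrite divr_gt0// subr_gt0.
exists (- ln q).
  rewrite oppr_ge0; apply: ln_le0; rewrite /q ler_pdivrMr// mul1r.
  by rewrite (@le_trans _ _ 1)// ?gerBl ?expR_ge0// ler1n.
rewrite opprK lnK ?posrE// /q mulrC divfK ?gt_eqF//.
by rewrite addrC subrK.
Qed.

Let rate Y (e : R) : \bar R :=
  limn_esup (fun n => (n%:R^-1)%:E * lne (spanning_sum f phi Y n e))%E.

Lemma le_spanning_sum Y n (e e' : R) : e <= e' ->
  (spanning_sum f phi Y n e' <= spanning_sum f phi Y n e)%E.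
Proof.
move=> ee; apply: le_ereal_inf_tmp => _ [F [finF FY sF] <-].
apply: ereal_inf_lbound; exists F => //; split=> // x /sF[y Fy xy].
by exists y => // i /xy/le_trans; apply.
Qed.

Lemma spanning_sum_ge0 Y n (e : R) : (0 <= spanning_sum f phi Y n e)%E.
Proof.
apply: le_ereal_inf_tmp => _ [F _ <-]; rewrite lee_fin.
by rewrite fsumr_ge0// => x _; exact: expR_ge0.
Qed.

Lemma classic_rate_cvg Y : cvg (rate Y e @[e --> 0^'+]).
Proof.
apply: nonincreasing_at_right_is_cvge; near=> e0 => e e' _ _ ee.
apply: le_limn_esup => n; apply: lee_wpmul2l; first by rewrite lee_fin invr_ge0.
rewrite lee_lne ?le_spanning_sum//; rewrite in_itv/= leey andbT; exact: spanning_sum_ge0.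
Unshelve. all: by end_near. Qed.

(** The entropy inequality of the variational principle.  The length [c1] of a
    correction is fixed first; then closed sets inside the cells are chosen that
    miss so little mass that the mean cost of corrections is small, and last the
    scale at which these closed sets are told apart. *)
Lemma entropy_wrt_le_classic mu Y r (A : 'I_r -> set (borel X)) :
  invariant_measure f mu -> closed Y -> mu Y = 1%E -> finite_partition A ->
  ((entropy_wrt f mu A)%:E + (mean mu phi)%:E <= lim (rate Y e @[e --> 0^'+]))%E.
Proof.
move=> inv cY muY partA; have [mA tA UA] := partA.
have [c cP] := finite_partition_label partA.
have mf := continuous_borel_fun contf.
have bphi := continuous_bounded_measurable cptX contphi.
have r0 : (0 < r)%N by apply: leq_trans (ltn_ord (c point)).
(* Three errors come from the code and one from the limit of H_n / n. *)
apply/lee_addgt0Pr => eps' eps'0; pose eps := eps' / 4.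
have eps0 : 0 < eps by rewrite divr_gt0.
have [c1 c1_ge0 kraft] := expR_code_lengths eps0 r0.
pose beta := eps / (c1 + 1) / r%:R.
have c1p : 0 < c1 + 1 by rewrite ltr_wpDl.
have beta0 : 0 < beta by rewrite !divr_gt0// ltr0n.
have /choice[B BP] : forall i, exists C : set X,
    [/\ closed C, C `<=` A i & fine (mu (A i `\` C)) <= beta].
  by move=> i; exact: closed_inner_regular.
have cB i : closed (B i) by have [] := BP i.
have BA i : B i `<=` A i by have [] := BP i.
have muB i : fine (mu (A i `\` B i)) <= beta by have [] := BP i.
have [e2 e20 sep] : exists2 e : R, 0 < e & forall z i j u v,
    B i u -> B j v -> ball z e u -> ball z e v -> i = j.
  apply: closed_disjoint_separated => // i j x /BA/cP <- /BA/cP; exact.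
have [e3 e30 osc3] := uniform_continuity cptX contphi eps0.
have mBi i : measurable (A i `\` B i : set (borel X)).
  by apply: measurableD => //; exact: closed_borel.
have mbad : measurable (~` \bigcup_i B i : set (borel X)).
  by apply: measurableC; apply: fin_bigcup_measurable => // i _; exact: closed_borel.
have bad_le : c1 * fine (mu (~` \bigcup_i B i)) <= eps.
  have : fine (mu (~` \bigcup_i B i)) <= \sum_(i < r) beta.
    apply: (@le_trans _ _ (\sum_(i < r) fine (mu (A i `\` B i)))); last exact: ler_sum.
    rewrite -(mean_indic mu mbad) (eq_bigr (fun i => mean mu \1_(A i `\` B i))); last first.
      by move=> i _; rewrite mean_indic.
    have bi i := @bounded_measurable_indic R _ _ _ (mBi i).
    rewrite -mean_sum//; apply: le_mean => //.
    - exact: bounded_measurable_indic.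
    - exact: bounded_measurable_sum.
    move=> x; rewrite indicE; case: (boolP (x \in _)) => [/set_mem nBx|_] /=; last first.
      by rewrite sumr_ge0.
    rewrite (bigD1 (c x))//= indicE mem_set ?lerDl ?sumr_ge0//.
    by split; [exact/cP|move=> Bx; apply: nBx; exists (c x)].
  rewrite sumr_const card_ord -mulr_natr /beta divfK ?gt_eqF ?ltr0n// => badle.
  have := ler_wpM2l c1_ge0 badle; move/le_trans; apply.
  have frac1 : c1 / (c1 + 1) <= 1 by rewrite ler_pdivrMr// mul1r lerDl.
  by have := ler_wpM2l (ltW eps0) frac1; rewrite mulr1 mulrCA.
pose e1 := Num.min e2 e3.
have e10 : 0 < e1 by rewrite lt_min e20.
have sep1 z i j u v : B i u -> B j v -> ball z e1 u -> ball z e1 v -> i = j.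
  have e12 : e1 <= e2 by rewrite /e1 ge_min lexx.
  by move=> Bu Bv /(le_ball e12) zu /(le_ball e12); exact: sep zu.
have osc1 x y : ball x e1 y -> phi x <= phi y + eps.
  have e13 : e1 <= e3 by rewrite /e1 ge_min lexx orbT.
  move=> /(le_ball e13)/osc3/ltW/(le_trans (ler_norm _)).
  by rewrite lerBlDl.
have mY := closed_borel cY.
have bound n (e : R) : e < e1 -> ((expR (join_entropy f mu A n + n%:R * mean mu phi -
    n%:R * (3 * eps)))%:E <= spanning_sum f phi Y n e)%E.
  move=> ee1; apply: le_ereal_inf_tmp => _ [F [finF FY sF] <-].
  rewrite lee_fin fsbig_finite//=.
  set s := finmap.enum_fset _.
  have span x : Y x -> exists2 y, y \in s & forall i, (i < n)%N ->
      ball (iter i f x) e1 (iter i f y).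
    move=> /sF[y Fy xy]; exists y.
      by have := in_fset_set finF y; rewrite mem_set.
    by move=> i /xy xyi; rewrite ballEmdist/=; exact: le_lt_trans ee1.
  have := join_entropy_le_spanning mf inv mA cP bphi cB BA sep1 mY muY (ltW eps0)
    c1_ge0 kraft osc1 span.
  set S := \sum_(y <- s) _ => hS.
  have S0 : 0 < S.
    have [x Yx] : exists x, Y x.
      apply/not_existsP => nY; have Y0 : Y = set0 by apply/seteqP; split=> // x /nY.
      by move: muY; rewrite Y0 measure0 => /eqP; rewrite eq_sym onee_eq0.
    have [y ys _] := span x Yx; rewrite /S (big_rem y)//= ltr_pwDl ?expR_gt0//.
    by rewrite sumr_ge0// => *; exact: expR_ge0.
  rewrite -[leRHS](lnK (x := S)) ?posrE// ler_expR lerBlDr; apply: (le_trans hS).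
  rewrite lerD2l ler_wpM2l//; move: bad_le; lra.
have rate_ge (e : R) : e < e1 ->
    ((entropy_wrt f mu A + mean mu phi - 4 * eps)%:E <= rate Y e)%E.
  move=> ee1; apply: limn_esup_ge.
  have /cvgrPdist_le/(_ _ eps0) := entropy_wrt_cvg mf inv mA cP.
  move=> cvE; near=> n.
  have n0 : (0 < n)%N by near: n; exact: nbhs_infty_gt.
  have n0' : 0 < n%:R :> R by rewrite ltr0n.
  have hn : entropy_wrt f mu A - join_entropy f mu A n / n%:R <= eps.
    apply: le_trans (ler_norm _) _; near: n; exact: cvE.
  have nonneg (z : \bar R) : (0 <= z)%E -> z \in `[0%E, +oo%E].
    by move=> z0; rewrite in_itv/= leey andbT.
  have := bound n e ee1.
  rewrite -lee_lne; [|by apply: nonneg; rewrite lee_fin expR_ge0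
                     |by apply: nonneg; exact: spanning_sum_ge0].
  have lne_expR (z : R) : lne (expR z)%:E = z%:E by rewrite /lne leNgt expR_gt0/= expRK.
  rewrite lne_expR => lnle.
  have : ((n%:R^-1)%:E * (join_entropy f mu A n + n%:R * mean mu phi - n%:R * (3 * eps))%:E
      <= (n%:R^-1)%:E * lne (spanning_sum f phi Y n e))%E.
    by apply: lee_wpmul2l => //; rewrite lee_fin invr_ge0 ltW.
  apply: le_trans; rewrite -EFinM lee_fin !mulrBr mulrDr !mulKf ?gt_eqF//.
  by move: hn; rewrite (mulrC n%:R^-1); lra.
apply: (@le_trans _ _ ((entropy_wrt f mu A + mean mu phi - 4 * eps)%:E + eps'%:E)%E).
  by rewrite -!EFinD lee_fin /eps; lra.
apply: leeD2r; apply: lime_ge; first exact: classic_rate_cvg.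
near=> e; apply: rate_ge; near: e; exact: nbhs_right_lt.
Unshelve. all: by end_near. Qed.

Lemma limit_free_energy_le_classic x mu Y : limit_measures f x mu ->
  closed Y -> Y x -> forward_invariant f Y ->
  (free_energy f phi mu <= lim (rate Y e @[e --> 0^'+]))%E.
Proof.
move=> lmu cY Yx fY.
have orbY n : Y (iter n f x).
  by elim: n => // n IH; apply: fY; exists (iter n f x).
have muY := limit_measure_support lmu cY orbY.
have [inv _] := lmu.
rewrite /free_energy mean_EFin; last exact: continuous_bounded_measurable.
rewrite -leeBrDr//; apply: ge_ereal_sup => _ [r [A [partA ->]]].
by rewrite leeBrDr//; exact: entropy_wrt_le_classic.
Qed.

End UpperBound.

(** * Sums over unions and images *)

Section UnconditionalSums.
Context {R : realType}.
Local Open Scope ereal_scope.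

Lemma subset_esum (T : choiceType) (P Q : set T) (a : T -> \bar R) :
  (forall x, 0 <= a x) -> P `<=` Q -> \esum_(x in P) a x <= \esum_(x in Q) a x.
Proof.
move=> a0 PQ; rewrite [leRHS](esumID P)// setIC setIidl//.
by rewrite leeDl// esum_ge0.
Qed.

Lemma esum_bigcup_le (T : choiceType) (G : nat -> set T) (a : T -> \bar R) :
  (forall x, 0 <= a x) ->
  \esum_(x in \bigcup_n G n) a x <= \sum_(0 <= n <oo) \esum_(x in G n) a x.
Proof.
move=> a0; rewrite seqDU_bigcup_eq (nneseries_sum_bigcup (trivIset_seqDU G) a0).
apply: lee_nneseries => [n _ _|n _]; first exact: esum_ge0.
by apply: subset_esum => //; exact: subset_seqDU.
Qed.

Lemma esum_image_le (T T' : choiceType) (t : T -> T') (P : set T) (a : T' -> \bar R) :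
  (forall x, 0 <= a x) ->
  \esum_(y in t @` P) a y <= \esum_(x in P) a (t x).
Proof.
move=> a0; have [->|/set0P[x0 Px0]] := eqVneq P set0.
  by rewrite image_set0 esum_set0 esum_ge0.
have /choice[g gP] : forall y, exists x, (t @` P) y -> P x /\ t x = y.
  move=> y; have [[x Px xy]|nP] := pselect ((t @` P) y); first by exists x.
  by exists x0 => /nP.
have -> : t @` P = t @` (g @` (t @` P)).
  apply/seteqP; split=> [y Py|y [x [z Pz <-] <-]].
    by have [Pg gy] := gP y Py; exists (g y) => //; exists y.
  by have [Pg ->] := gP z Pz.
rewrite esum_image; last first.
  move=> x y; rewrite !inE => -[z Pz <-] [w Pw <-].
  by have [_ ->] := gP z Pz; have [_ ->] := gP w Pw => ->.
apply: subset_esum => [x|x [y Py <-]]; first exact: a0.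
by have [] := gP y Py.
Qed.

Lemma esum_finType (J : finType) (P : pred J) (a : J -> \bar R) :
  (forall x, 0 <= a x) -> \esum_(x in [set x | P x]) a x = \sum_(x | P x) a x.
Proof.
move=> a0; rewrite esum_fset//; last exact: finite_finset.
rewrite -(@bigfs _ _ _ _ (index_enum J) P a (index_enum_uniq J))// => i _.
by rewrite mem_index_enum.
Qed.

End UnconditionalSums.

(** * Pesin-Pitskel pressure of a cover *)

Section PesinPitskel.
Context {R : realType} {X : pointedMetricType R}.
Variables (f : X -> X) (phi : X -> R).
Implicit Types (Z : set X) (U V : seq (set X)) (s : seq (set X)).

Lemma string_weight_ge0 a s : (0 <= string_weight f phi a s)%E.
Proof. exact: expeR_ge0. Qed.

Lemma pp_outer_ge0 Z a U N : (0 <= pp_outer f phi Z a U N)%E.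
Proof.
apply: le_ereal_inf_tmp => _ [G _ <-]; apply: esum_ge0 => s _.
exact: string_weight_ge0.
Qed.

Lemma pp_outer_nondecreasing Z a U :
  {homo pp_outer f phi Z a U : n m / (n <= m)%N >-> (n <= m)%E}.
Proof.
move=> n m nm; apply: le_ereal_inf_tmp => _ [G [cG sG ZG] <-].
apply: ereal_inf_lbound; exists G => //; split=> // s /sG[ms sU]; split=> //.
exact: leq_trans ms.
Qed.

Lemma pp_limit_eq0 Z a U : pp_limit f phi Z a U = 0%E <->
  forall N delta, 0 < delta -> exists G, covering_strings f Z U N G /\
    (\esum_(s in G) string_weight f phi a s <= delta%:E)%E.
Proof.
have cv := ereal_nondecreasing_cvgn (@pp_outer_nondecreasing Z a U).
have supE : pp_limit f phi Z a U = ereal_sup (range (pp_outer f phi Z a U)).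
  exact: cvg_lim cv.
rewrite supE; split=> [sup0 N delta delta0|small].
  have outer0 : pp_outer f phi Z a U N = 0%E.
    apply/eqP; rewrite eq_le pp_outer_ge0 andbT -sup0.
    by apply: ereal_sup_ubound; exists N.
  have [|_ [G covG <-]] := @lb_ereal_inf_adherent R
      [set \esum_(s in G) string_weight f phi a s | G in covering_strings f Z U N] _ delta0.
    by rewrite -/(pp_outer f phi Z a U N) outer0.
  rewrite -/(pp_outer f phi Z a U N) outer0 add0e => /ltW Gdelta.
  by exists G.
apply/eqP; rewrite eq_le; apply/andP; split.
  apply: ge_ereal_sup => _ [N _ <-]; apply/lee_addgt0Pr => delta delta0.
  have [G [covG Gdelta]] := small N _ delta0; rewrite add0e.
  by apply: le_trans Gdelta; apply: ereal_inf_lbound; exists G.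
apply: le_ereal_sup_tmp; exists (pp_outer f phi Z a U 0); first by exists 0%N.
exact: pp_outer_ge0.
Qed.

(** Countable stability, the reason why it suffices to treat together the points
    that share a block length and a code. *)
Lemma pp_limit_bigcup Z (Zs : nat -> set X) a U :
  (forall i, pp_limit f phi (Zs i) a U = 0%E) -> Z `<=` \bigcup_i Zs i ->
  pp_limit f phi Z a U = 0%E.
Proof.
move=> Zs0 ZZs; apply/pp_limit_eq0 => N delta delta0.
have /choice[G GP] : forall i, exists G, covering_strings f (Zs i) U N G /\
    (\esum_(s in G) string_weight f phi a s <= (delta / (2 ^ i.+1)%:R)%:E)%E.
  move=> i; have /pp_limit_eq0 := Zs0 i; apply.
  by rewrite divr_gt0// ltr0n expn_gt0.
exists (\bigcup_i G i); split; first split.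
- by apply: bigcup_countable => // i _; have [[]] := GP i.
- by move=> s [i _ Gis]; have [[_ sU _] _] := GP i; exact: sU.
- move=> x /ZZs[i _ /=]; have [[_ _ cov] _] := GP i => /cov[s Gis xs].
  by exists s => //; exists i.
apply: (le_trans (esum_bigcup_le _ (string_weight_ge0 a))).
apply: le_trans (epsilon_trick0 xpredT (ltW delta0)).
apply: lee_nneseries => [i _ _|i _]; last by have [] := GP i.
by apply: esum_ge0 => s _; exact: string_weight_ge0.
Qed.

Lemma pp_pressure_cover_le Z U (C : R) :
  (forall a, C < a -> pp_limit f phi Z a U = 0%E) ->
  (pp_pressure_cover f phi Z U <= C%:E)%E.
Proof.
move=> null; apply/lee_addgt0Pr => eps eps0; rewrite -EFinD.
by apply: ereal_inf_lbound; exists (C + eps) => //; apply: null; rewrite ltrDl.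
Qed.

Definition oscillation_le U (gam : R) :=
  forall A, A \in U -> forall x y, A x -> A y -> phi y <= phi x + gam.

Lemma string_set_oscillation U gam s x y : oscillation_le U gam ->
  {subset s <= U} -> string_set f s x -> string_set f s y ->
  birkhoff_sum f phi (size s) y <= birkhoff_sum f phi (size s) x + (size s)%:R * gam.
Proof.
move=> osc sU xs ys; rewrite /birkhoff_sum.
have -> : (size s)%:R * gam = \sum_(k < size s) gam by rewrite sumr_const card_ord mulr_natl.
rewrite -big_split/= ler_sum// => k _.
apply: (osc (nth set0 s k)); first by apply: sU; exact: mem_nth.
  exact: xs.
exact: ys.
Qed.

(** Comparison of a cover with a coarser one: a string of the finer cover lies
    in a string of the coarser one, on which [phi] oscillates by at most [gam]. *)
Lemma pp_pressure_cover_refine Z U V gam : oscillation_le U gam ->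
  (forall B, B \in V -> exists2 A, A \in U & B `<=` A) ->
  (pp_pressure_cover f phi Z U <= pp_pressure_cover f phi Z V + gam%:E)%E.
Proof.
move=> osc ref; rewrite -leeBlDr//.
apply: le_ereal_inf_tmp => _ [a aP <-]; rewrite leeBlDr// -EFinD.
apply: ereal_inf_lbound; exists (a + gam) => //; apply/pp_limit_eq0 => N delta delta0.
have [G [[cG GN ZG] Gdelta]] := (pp_limit_eq0 Z a V).1 aP N delta delta0.
have /choice[t tP] : forall B : set X, exists A, B \in V -> A \in U /\ B `<=` A.
  move=> B; have [BV|_] := boolP (B \in V); last by exists B.
  by have [A AU BA] := ref B BV; exists A.
(* Strings without points are discarded: their image could contain points. *)
pose G0 := G `&` [set s | string_set f s !=set0].
have sub s x : G s -> string_set f s x -> string_set f (map t s) x.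
  move=> Gs xs j; rewrite size_map => js; rewrite (nth_map set0)//.
  have [_ sV] := GN s Gs.
  by have [_ +] := tP _ (sV _ (mem_nth set0 js)); apply; exact: xs.
have mapU s : G s -> {subset map t s <= U}.
  move=> Gs _ /mapP[B Bs ->]; have [_ sV] := GN s Gs.
  by have [] := tP B (sV B Bs).
exists (map t @` G0); split; first split.
- apply: sub_countable cG; apply: (card_le_trans (card_image_le _ _)).
  by apply: subset_card_le => s [].
- by move=> _ [s [Gs _] <-]; rewrite size_map; split; [have [] := GN s Gs|exact: mapU].
- move=> x /ZG[s Gs xs]; exists (map t s); last exact: sub.
  by exists s => //; split=> //; exists x.
apply: (le_trans (esum_image_le _ _ (string_weight_ge0 _))).
apply: (@le_trans _ _ (\esum_(s in G0) string_weight f phi a s)%E); last first.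
  apply: le_trans Gdelta; apply: subset_esum => [s|s []//]; exact: string_weight_ge0.
apply: le_esum => s [Gs [x xs]]; rewrite /string_weight lee_expeR size_map.
apply: (@le_trans _ _ ((- (a + gam) * (size s)%:R)%:E +
   (birkhoff_sum f phi (size s) x + (size s)%:R * gam)%:E)%E).
  rewrite leeD2l//; apply: ge_ereal_sup => _ [y ys <-]; rewrite lee_fin.
  have := string_set_oscillation osc (mapU s Gs) (sub s x Gs xs) ys.
  by rewrite size_map.
rewrite -EFinD (_ : _ + _ = - a * (size s)%:R + birkhoff_sum f phi (size s) x); last by ring.
rewrite EFinD leeD2l//; apply: ereal_sup_ubound; by exists x.
Qed.

End PesinPitskel.

(** * The limit over covers *)

Section MeshLimit.
Context {R : realType} {X : pointedMetricType R}.
Hypothesis cptX : compact [set: X].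

Lemma mesh_mdist (U : seq (set X)) (e : R) A x y : (mesh U < e%:E)%E ->
  A \in U -> A x -> A y -> mdist x y < e.
Proof.
move=> Ue AU Ax Ay; rewrite -lte_fin; apply: le_lt_trans Ue.
apply: (@le_trans _ _ (diameter A)).
  by apply: ereal_sup_ubound; exists (x, y).
by apply: ereal_sup_ubound; exists A.
Qed.

Lemma mesh_to_0_proper : ProperFilter (@mesh_to_0 R X).
Proof.
apply: filter_from_proper; last first.
  move=> e e0; have e40 : 0 < e / 4 by rewrite divr_gt0.
  have e80 : 0 < e / 4 / 2 by rewrite divr_gt0.
  have [N [p [c pc]]] := finite_net cptX e80.
  exists [seq (ball (p i) (e / 4))° | i <- enum 'I_N.+1]; split; first split.
  - by move=> A /mapP[i _ ->]; exact: open_interior.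
  - apply/seteqP; split=> // x _.
    exists ((ball (p (c x)) (e / 4))°).
      by apply/mapP; exists (c x); rewrite ?mem_enum.
    rewrite /interior -nbhs_ballE; exists (e / 4 / 2) => // y xy.
    by rewrite [e / 4]splitr; exact: ball_triangle (pc x) xy.
  apply: (@le_lt_trans _ _ (e / 2)%:E); last first.
    by rewrite lte_fin ltr_pdivrMr// ltr_pMr// ltr1n.
  apply: ge_ereal_sup => _ [A /= /mapP[i _ ->] <-].
  apply: ge_ereal_sup => _ [[u v] /= [/interior_subset iu /interior_subset iv] <-].
  move: iu iv; rewrite !ballEmdist/= lee_fin => iu iv.
  rewrite (le_trans (metric_triangle _ (p i) _))// metric_sym.
  by move: iu iv; lra.
apply: filter_from_filter; first by exists 1; exact: ltr01.
move=> e1 e2 /= e10 e20; exists (Num.min e1 e2); first by rewrite /= lt_min e10.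
by move=> U [cU]; rewrite EFin_min lt_min => /andP[U1 U2].
Qed.

(** The first hypothesis makes the family converge, to its lower limit; the bound
    passes to the limit only then, as [lim] is a default value for a family that
    does not converge. *)
Lemma almost_monotone_lim_le (T : Type) (F : set_system T) (FF : ProperFilter F)
    (g : T -> \bar R) (C : R) :
  (forall eps, 0 < eps -> \forall U \near F, \forall V \near F, (g U <= g V + eps%:E)%E) ->
  (forall eps, 0 < eps -> \forall U \near F, (g U <= (C + eps)%:E)%E) ->
  (lim (g @ F) <= C%:E)%E.
Proof.
move=> mono bounded.
suff cvg_g : cvg (g @ F).
  apply/lee_addgt0Pr => eps eps0; rewrite -EFinD; apply: lime_le => //.
  exact: bounded.
pose S := [set x : R | \forall U \near F, (x%:E <= g U)%E].
(* The supremum of [S] is the lower limit; if [S] is empty the family is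
   eventually equal to -oo. *)
have [S0|/set0P[x0 Sx0]] := eqVneq S set0.
  apply/cvg_ex; exists -oo%E; apply: cvg_near_cst.
  have := mono 1 ltr01; have := bounded 1 ltr01; apply: filterS2 => U gU monoU.
  case gUE : (g U) => [x| |//]; last by move: gU; rewrite gUE.
  suff : S (x - 1) by rewrite S0.
  by apply: filterS monoU => V; rewrite gUE -leeBlDr// -EFinB.
have supS : has_sup S.
  split; first by exists x0.
  exists (C + 1) => x Sx; have [U [xU UC]] := filter_ex (filterI Sx (bounded 1 ltr01)).
  by rewrite -lee_fin; exact: le_trans UC.
apply/cvg_ex; exists (sup S)%:E.
have fing : \forall U \near F, g U \is a fin_num.
  apply: filterS2 (bounded 1 ltr01) (Sx0 : F _) => U UC xU.
  by rewrite fin_numE -ltNye -ltey (lt_le_trans (ltNyr _) xU)/= (le_lt_trans UC)// ltry.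
apply/fine_cvgP; split=> //; apply/cvgrPdist_le => eps eps0.
have eps20 : 0 < eps / 2 by rewrite divr_gt0.
have [x Sx xsup] := sup_adherent eps0 supS.
apply: filterS3 fing (Sx : F _) (mono _ eps0) => U Ufin xU monoU.
rewrite ler_norml; apply/andP; split.
  rewrite lerBrDl; apply: sup_upper_bound => //=.
  by apply: filterS monoU => V; rewrite -(fineK Ufin) -leeBlDr// -EFinB.
rewrite lerBlDr addrC -lerBlDr; apply/ltW/(lt_le_trans xsup).
by rewrite -lee_fin fineK.
Qed.

End MeshLimit.

(** * Rational codes *)

Section RationalCodes.
Context {R : realType} (I : finType).

(** Code lengths of a rational distribution.  There are only countably many of
    these, and they are optimal up to any positive error. *)
Definition rational_code (a : {ffun I -> nat}) (i : I) : R :=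
  - ln ((a i).+1%:R / \sum_j (a j).+1%:R).

Let total (a : {ffun I -> nat}) : R := \sum_j (a j).+1%:R.

Let le_total (a : {ffun I -> nat}) i : (a i).+1%:R <= total a.
Proof. by rewrite /total (bigD1 i)//= lerDl sumr_ge0. Qed.

Let total_gt0 (a : {ffun I -> nat}) (i : I) : 0 < total a.
Proof. by apply: lt_le_trans (le_total a i); rewrite ltr0n. Qed.

Lemma rational_code_ge0 a i : 0 <= rational_code a i.
Proof.
by rewrite oppr_ge0 ln_le0// ler_pdivrMr ?(total_gt0 a i)// mul1r le_total.
Qed.

Lemma rational_code_kraft a : \sum_i expR (- rational_code a i) <= 1.
Proof.
apply: (@le_trans _ _ (\sum_i (a i).+1%:R / total a)).
  by apply: ler_sum => i _; rewrite opprK lnK// posrE divr_gt0// (total_gt0 a i).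
rewrite -mulr_suml -/(total a); have [->|t0] := eqVneq (total a) 0.
  by rewrite mul0r.
by rewrite divff.
Qed.

Lemma rational_code_approx (p : I -> R) eps : (forall i, 0 <= p i) ->
  \sum_i p i = 1 -> 0 < eps ->
  exists a, \sum_i p i * rational_code a i <= - (\sum_i p i * ln (p i)) + eps.
Proof.
move=> p0 p1 eps0; pose n : R := #|I|%:R.
(* Rounding [p i * M] down and adding one loses at most the factor
   M / (M + #|I|) in the probability of [i]. *)
near (\oo : set_system nat) => M.
have M0 : 0 < M%:R :> R by rewrite ltr0n; near: M; exact: nbhs_infty_gt.
have Mn : n / eps <= M%:R by near: M; exact: nbhs_infty_ger.
pose a := [ffun i => Num.truncn (p i * M%:R)].
have aM i : p i * M%:R <= (a i).+1%:R by rewrite ffunE ltW// truncnS_gt.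
have p1Z (u : R) : u = \sum_i p i * u by rewrite -mulr_suml p1 mul1r.
have totM : total a <= M%:R + n.
  rewrite [X in _ <= X + _]p1Z /n -sum1_card natr_sum -big_split/=.
  apply: ler_sum => i _; rewrite -natr1 lerD2r ffunE.
  by rewrite truncn_le mulr_ge0// ltW.
exists a; rewrite -sumrN [X in _ <= _ + X]p1Z -big_split/=.
apply: ler_sum => i _; have := p0 i; rewrite le_eqVlt => /predU1P[<-|pi0].
  by rewrite !mul0r oppr0 addr0.
rewrite -mulrN -mulrDr ler_pM2l//.
have n0 : 0 <= n by exact: ler0n.
have Mn0 : 0 < M%:R + n by rewrite ltr_pwDl.
have q_ge : p i * (M%:R / (M%:R + n)) <= (a i).+1%:R / total a.
  rewrite mulrA ler_pdivrMr// mulrAC ler_pdivlMr ?(total_gt0 a i)//.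
  by apply: ler_pM => //; [rewrite mulr_ge0// ltW|rewrite ltW// (total_gt0 a i)].
have lnq : ln (p i * (M%:R / (M%:R + n))) <= ln ((a i).+1%:R / total a).
  by rewrite ler_ln// posrE ?mulr_gt0 ?invr_gt0// (total_gt0 a i).
rewrite lnM ?posrE ?divr_gt0// in lnq.
have lnMn : - ln (M%:R / (M%:R + n)) <= eps.
  rewrite -lnV ?posrE ?divr_gt0// invf_div mulrDl divff ?gt_eqF//.
  apply: le_trans (le_ln1Dx _) _; first by rewrite (lt_le_trans (ltrN10 _))// divr_ge0// ltW.
  by rewrite ler_pdivrMr// mulrC -ler_pdivrMr.
rewrite /rational_code -/(total a); lra.
Unshelve. all: by end_near. Qed.

End RationalCodes.

(** * Strings made of coded blocks *)

Section Coding.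
Context {R : realType} {X : pointedMetricType R}.
Variables (f : X -> X) (phi : X -> R) (U : seq (set X)) (m' : nat).
Local Notation m := m'.+1.
Local Notation word := {ffun 'I_m -> 'I_(size U)}.
Variable b : word -> R.

(** The prefix, of length less than [m], is stored as the beginning of a word so
    that the data of a string range over one finite type. *)
Definition block_string k (j : ('I_m * word) * {ffun 'I_k.+1 -> word}) : seq (set X) :=
  mkseq (fun t => nth set0 U (if (t < j.1.1)%N then j.1.2 (inord t)
     else j.2 (inord ((t - j.1.1) %/ m)) (inord ((t - j.1.1) %% m))))
    (j.1.1 + k.+1 * m).

Lemma size_block_string k (j : ('I_m * word) * {ffun 'I_k.+1 -> word}) :
  size (block_string j) = (j.1.1 + k.+1 * m)%N.
Proof. by rewrite size_mkseq. Qed.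

Lemma block_string_subset k (j : ('I_m * word) * {ffun 'I_k.+1 -> word}) :
  {subset block_string j <= U}.
Proof. by move=> A /mapP[t _ ->]; apply: mem_nth. Qed.

Definition word_set (w : word) : set X :=
  [set y | forall l : 'I_m, nth set0 U (w l) (iter l f y)].

Lemma block_stringP k (j : ('I_m * word) * {ffun 'I_k.+1 -> word}) x :
  (forall t : 'I_m, (t < j.1.1)%N -> nth set0 U (j.1.2 t) (iter t f x)) ->
  (forall i : 'I_k.+1, word_set (j.2 i) (iter (j.1.1 + i * m) f x)) ->
  string_set f (block_string j) x.
Proof.
move=> pre bl t; rewrite size_block_string => tN; rewrite nth_mkseq//.
case: ifP => ts.
  have tm : (t < m)%N := ltn_trans ts (ltn_ord j.1.1).
  have := pre (Ordinal tm) ts; rewrite (_ : inord t = Ordinal tm)//.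
  by apply: val_inj; rewrite /= inordK.
set q := ((t - j.1.1) %/ m)%N; set l := ((t - j.1.1) %% m)%N.
have lm : (l < m)%N by rewrite ltn_mod.
have st : (j.1.1 <= t)%N by rewrite leqNgt ts.
have qk : (q < k.+1)%N by rewrite ltn_divLR// ltn_subLR.
have := bl (inord q) (inord l); rewrite !inordK// -iterD.
by rewrite addnCA [(l + _)%N]addnC /q /l -divn_eq subnKC.
Qed.

(** Energy and code length together stay below [C] per unit of time, along
    arbitrarily long strings. *)
Definition coded (C : R) : set X := [set x | forall K, exists2 k, (K <= k)%N &
  exists j : ('I_m * word) * {ffun 'I_k.+1 -> word},
    string_set f (block_string j) x /\
    birkhoff_sum f phi (size (block_string j)) x + \sum_i b (j.2 i) <=
      (size (block_string j))%:R * C].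

Hypothesis kraft : \sum_w expR (- b w) <= 1.

Lemma sum_block_strings k (rho : R) : 0 <= rho ->
  \sum_(j : ('I_m * word) * {ffun 'I_k.+1 -> word}) rho * \prod_i expR (- b (j.2 i))
  <= rho * #|{: 'I_m * word}|%:R.
Proof.
move=> rho0; rewrite -mulr_sumr ler_wpM2l//.
rewrite -(pair_bigA _ (fun (a : 'I_m * word) (bl : {ffun 'I_k.+1 -> word}) =>
  \prod_i expR (- b (bl i))))/=.
rewrite -(bigA_distr_bigA (fun (_ : 'I_k.+1) w => expR (- b w)))/=.
rewrite sumr_const -[leLHS]mulr_natr ler_piMl// prodr_ile1// => i _.
by rewrite kraft andbT sumr_ge0// => w _; exact: expR_ge0.
Qed.

Lemma geometric_nneseries_le (a rho : R) : 0 <= a -> 0 < rho < 1 ->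
  (\sum_(0 <= n <oo) (a * rho ^+ n)%:E <= (a / (1 - rho))%:E)%E.
Proof.
move=> a0 /andP[rho0 rho1]; apply: lime_le.
  by apply: is_cvg_nneseries => n _ _; rewrite lee_fin mulr_ge0// exprn_ge0// ltW.
apply: nearW => n; rewrite sumEFin lee_fin.
by apply: geometric_le_lim => //; rewrite gtr0_norm.
Qed.

(** The bound on energy plus code length turns the Gibbs weight of a string into
    exp (- eta N) times the product of the probabilities that the code gives to its
    blocks, and these products sum to at most one by Kraft's inequality. *)
Lemma pp_limit_coded (C gam alpha : R) : oscillation_le phi U gam ->
  C + gam < alpha -> pp_limit f phi (coded C) alpha U = 0%E.
Proof.
move=> osc Calpha; apply/pp_limit_eq0 => N delta delta0.
pose eta := alpha - C - gam; have eta0 : 0 < eta by rewrite /eta; lra.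
pose rho := expR (- eta); have rho0 : 0 < rho := expR_gt0 _.
have rho1 : rho < 1 by rewrite /rho -expR0 ltr_expR oppr_lt0.
pose J : R := #|{: 'I_m * word}|%:R.
have J0 : 0 <= J by exact: ler0n.
have [K NK JK] : exists2 K, (N <= K)%N & rho ^+ K * J / (1 - rho) <= delta.
  have cv : rho ^+ K * J / (1 - rho) @[K --> \oo] --> 0 * J / (1 - rho).
    apply: cvgMl; apply: cvgMl; apply: cvg_expr.
    by rewrite gtr0_norm.
  rewrite !mul0r in cv; have /cvgr0Pnorm_le/(_ _ delta0) small := cv.
  have [K [small_K NK]] := filter_ex (filterI small (nbhs_infty_ge N)).
  by exists K => //; exact: le_trans (ler_norm _) small_K.
pose good k (j : ('I_m * word) * {ffun 'I_k.+1 -> word}) := exists x,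
    string_set f (block_string j) x /\
    birkhoff_sum f phi (size (block_string j)) x + \sum_i b (j.2 i) <=
      (size (block_string j))%:R * C.
pose G n := @block_string (K + n) @` [set j | good _ j].
have weight k (j : ('I_m * word) * {ffun 'I_k.+1 -> word}) : good k j ->
    (string_weight f phi alpha (block_string j) <=
     (rho ^+ k * \prod_i expR (- b (j.2 i)))%:E)%E.
  move=> [x [xj cost]]; rewrite /string_weight; set n := size _ in cost *.
  apply: (@le_trans _ _ (expeR (- (k%:R * eta) - \sum_i b (j.2 i))%:E)); last first.
    rewrite /= lee_fin expRD -sumrN expR_sum ler_pM2r ?prodr_gt0// => [|i _]; last exact: expR_gt0.
    by rewrite -mulrN expRM_natl.
  rewrite lee_expeR.
  apply: (@le_trans _ _ ((- alpha * n%:R)%:E + (birkhoff_sum f phi n x + n%:R * gam)%:E)%E).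
    rewrite leeD2l//; apply: ge_ereal_sup => _ [y yj <-]; rewrite lee_fin.
    exact: string_set_oscillation osc (@block_string_subset _ j) xj yj.
  have kn : k%:R * eta <= n%:R * eta.
    rewrite ler_pM2r// ler_nat /n size_block_string.
    by rewrite (leq_trans _ (leq_addl _ _))// mulSnr (leq_trans _ (leq_addr _ _))// leq_pmulr.
  rewrite -EFinD lee_fin; move: kn cost; rewrite /eta; lra.
exists (\bigcup_n G n); split; first split.
- apply: bigcup_countable => // n _; apply: finite_set_countable.
  by apply: finite_image; exact: finite_finset.
- move=> _ [n _ [j _ <-]]; split; last exact: block_string_subset.
  rewrite size_block_string (leq_trans NK)// (leq_trans (leq_addr n K))//.
  by rewrite (leq_trans _ (leq_addl _ _))// mulSnr (leq_trans _ (leq_addr _ _))// leq_pmulr.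
- move=> x /(_ K)[k Kk [j [xj cost]]].
  rewrite -(subnKC Kk) in j xj cost *.
  by exists (block_string j) => //; exists (k - K)%N => //; exists j => //; exists x.
apply: (le_trans (esum_bigcup_le _ (string_weight_ge0 f phi alpha))).
apply: (@le_trans _ _ (\sum_(0 <= n <oo) (rho ^+ K * J * rho ^+ n)%:E)%E); last first.
  apply: le_trans (geometric_nneseries_le _ _) _; rewrite ?lee_fin//.
    by rewrite mulr_ge0// exprn_ge0// ltW.
  by rewrite rho0.
apply: lee_nneseries => [n _ _|n _]; first by apply: esum_ge0 => s _; exact: string_weight_ge0.
apply: (le_trans (esum_image_le _ _ (string_weight_ge0 f phi alpha))).
pose bnd (j : ('I_m * word) * {ffun 'I_(K + n).+1 -> word}) : \bar R :=
  (rho ^+ (K + n) * \prod_i expR (- b (j.2 i)))%:E.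
have bnd0 j : (0 <= bnd j)%E.
  by rewrite lee_fin mulr_ge0 ?exprn_ge0 ?prodr_ge0// ?ltW// => i _; exact: expR_ge0.
apply: (@le_trans _ _ (\esum_(j in [set j | good (K + n)%N j]) bnd j)%E).
  by apply: le_esum => j; exact: weight.
apply: (@le_trans _ _ (\esum_(j in [set j | xpredT j]) bnd j)%E).
  by apply: subset_esum.
rewrite (esum_finType xpredT)// sumEFin lee_fin.
apply: (le_trans (sum_block_strings _ _)); first by rewrite exprn_ge0// ltW.
by rewrite exprD mulrAC.
Qed.

End Coding.

(** The phase with the least sum does no worse than the average phase. *)
Lemma exists_offset {R : realType} (m' k : nat) (F : nat -> R) :
  exists s : 'I_m'.+1, m'.+1%:R * \sum_(i < k) F (s + i * m'.+1)%N <=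
    \sum_(t < k * m'.+1) F t.
Proof.
pose a (s : 'I_m'.+1) := \sum_(i < k) F (s + i * m'.+1)%N.
have -> : \sum_(t < k * m'.+1) F t = \sum_s a s.
  rewrite /a; elim: k {a} => [|k IH].
    by rewrite mul0n big_ord0 big1// => s _; rewrite big_ord0.
  under [RHS]eq_bigr do rewrite big_ord_recr.
  rewrite big_split -IH mulSnr -(big_mkord xpredT) (big_cat_nat (leq0n (k * m'.+1)) (leq_addr _ _)).
  rewrite big_mkord; congr (_ + _).
  by rewrite -{1}[(k * m'.+1)%N]add0n big_addn addnC addnK big_mkord.
have [s _ smin] := @arg_minP _ _ _ (ord0 : 'I_m'.+1) xpredT a isT.
exists s; rewrite -/(a s) mulr_natl -[X in _ *+ X](card_ord m'.+1) -sumr_const.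
by apply: ler_sum => i _; exact: smin.
Qed.

(** * Free energy and Pesin-Pitskel pressure *)

Section Covering.
Context {R : realType} {X : pointedMetricType R}.
Variables (f : X -> X) (phi : X -> R).
Hypotheses (cptX : compact [set: X]) (contf : continuous f) (contphi : continuous phi).

Lemma cover_partition (U : seq (set X)) : finite_open_cover U ->
  exists (A : 'I_(size U) -> set (borel X)) (c : X -> 'I_(size U)),
  [/\ finite_partition A, forall y i, A i y <-> c y = i &
      forall y, nth set0 U (c y) y].
Proof.
move=> [oU cU]; pose F n : set (borel X) := nth set0 U n.
have oF n : open (F n : set X).
  have [nU|Un] := ltnP n (size U); first by apply: oU; exact: mem_nth.
  by rewrite /F nth_default//; exact: open0.
pose A (i : 'I_(size U)) := seqDU F i.
have partA : finite_partition A.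
  split.
  - by move=> i; apply: seqDU_measurable => n; exact: open_borel.
  - move=> i j _ _ ij; apply: val_inj; have := @trivIset_seqDU _ F i j I I ij; exact.
  - apply/seteqP; split=> // y _.
    have [B /= BU By] : (\bigcup_(B in [set` U]) B) y by rewrite cU.
    have : (\bigcup_n F n) y.
      by exists (index B U) => //; rewrite /F nth_index.
    rewrite seqDU_bigcup_eq => -[n _ ny].
    have nU : (n < size U)%N.
      rewrite ltnNge; apply/negP => Un; have := subset_seqDU ny.
      by rewrite /F nth_default.
    by exists (Ordinal nU).
have [c cP] := finite_partition_label partA.
exists A, c; split=> // y.
by have := (cP y (c y)).2 erefl; exact: subset_seqDU.
Qed.

Lemma birkhoff_sum_perturb (M : R) n0 n s x : (forall y, `|phi y| <= M) ->
  (n0 <= n)%N -> birkhoff_sum f phi (s + n0) x <=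
    birkhoff_sum f phi n x + (s + (n - n0))%:R * M.
Proof.
move=> phiM n0n.
have split_sum a b : birkhoff_sum f phi (a + b) x =
    birkhoff_sum f phi a x + birkhoff_sum f phi b (iter a f x).
  rewrite /birkhoff_sum big_split_ord; congr (_ + _).
  by apply: eq_bigr => i _; rewrite /= addnC iterD.
have bound b y : `|birkhoff_sum f phi b y| <= b%:R * M.
  rewrite /birkhoff_sum (le_trans (ler_norm_sum _ _ _))// mulr_natl.
  by rewrite -[X in _ *+ X](card_ord b) -sumr_const ler_sum.
have Sn : birkhoff_sum f phi n x =
    birkhoff_sum f phi n0 x + birkhoff_sum f phi (n - n0) (iter n0 f x).
  by rewrite -split_sum subnKC.
rewrite [(s + n0)%N]addnC split_sum Sn natrD mulrDl.
have := bound s (iter n0 f x); have := bound (n - n0)%N (iter n0 f x).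
by rewrite !ler_norml => /andP[+ _] /andP[_ +]; lra.
Qed.

Lemma word_set_open (U : seq (set X)) m' (w : {ffun 'I_m'.+1 -> 'I_(size U)}) :
  finite_open_cover U -> open (word_set f w).
Proof.
move=> [oU _]; rewrite openE => y yw; rewrite /interior.
apply: filter_forall => l.
have : open (iter l f @^-1` nth set0 U (w l)).
  apply: open_comp => [z _|]; first exact: iter_continuous.
  by apply: oU; exact: mem_nth.
by rewrite openE => /(_ y (yw l)).
Qed.

(** The cheapest word available at a point is an upper semicontinuous function
    of it; so along the orbit of [x] it costs on average at most its mean, which
    is at most the entropy of the words. *)
Lemma cheapest_word_average x mu n_ (U : seq (set X)) m' (A : 'I_(size U) -> set (borel X))
    (c : X -> 'I_(size U)) (b : {ffun 'I_m'.+1 -> 'I_(size U)} -> R) eps :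
  invariant_measure f mu -> (n_ @ \oo --> \oo)%classic ->
  (forall psi, continuous psi ->
     orbit_average f x (n_ k) psi @[k --> \oo] --> mean mu psi) ->
  finite_open_cover U -> (forall i, measurable (A i)) ->
  (forall y i, A i y <-> c y = i) ->
  (forall y, nth set0 U (c y) y) -> (forall w, 0 <= b w) -> 0 < eps ->
  exists best : X -> {ffun 'I_m'.+1 -> 'I_(size U)},
    (forall y, word_set f (best y) y) /\
    \forall k \near \oo, orbit_average f x (n_ k) (b \o best) <=
      mean mu (fun y => b (itinerary f c m'.+1 y)) + eps.
Proof.
move=> inv n_oo cv covU mA cP cU b0 eps0.
have mf := continuous_borel_fun contf.
have itw y : word_set f (itinerary f c m'.+1 y) y.
  by move=> l; rewrite ffunE; exact: cU.
have /choice[best bestP] : forall y, exists w, word_set f w y /\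
    forall v, word_set f v y -> b w <= b v.
  move=> y; pose P (w : {ffun 'I_m'.+1 -> 'I_(size U)}) := `[< word_set f w y >].
  have P0 : P (itinerary f c m'.+1 y) by apply/asboolP.
  have [w /asboolP wy wmin] := @arg_minP _ _ _ _ P b P0.
  by exists w; split=> // v vy; apply: wmin; apply/asboolP.
exists best; split; first by move=> y; have [] := bestP y.
(* An upper bound for [b], so that [h] takes its values in the unit interval. *)
pose B := 1 + \sum_w b w.
have B0 : 0 < B by rewrite ltr_pwDl// sumr_ge0.
have bB w : b w <= B.
  by rewrite /B (bigD1 w)//= addrCA lerDl addr_ge0// sumr_ge0.
pose g y := b (best y); pose h y := 1 + - B^-1 * g y.
have gB y : 0 <= B^-1 * g y <= 1.
  apply/andP; split; first by rewrite mulr_ge0 ?invr_ge0 ?b0// ltW.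
  by rewrite ler_pdivrMl// mulr1 bB.
have h01 y : 0 <= h y <= 1 by have := gB y; rewrite /h mulNr => /andP[]; lra.
have lsch t : open [set y | t < h y].
  have -> : [set y | t < h y] =
      \bigcup_(w in [set w | b w < (1 - t) * B]) word_set f w.
    have lt_iff v : (t < 1 + - B^-1 * v) = (v < (1 - t) * B).
      by rewrite mulNr ltrBrDr addrC -ltrBrDr ltr_pdivrMl// mulrC.
    apply/seteqP; split=> y /=.
      by rewrite /h lt_iff => gt; exists (best y) => //; have [] := bestP y.
    move=> [w /= wt wy]; rewrite /h lt_iff; apply: le_lt_trans wt.
    by have [_] := bestP y; apply.
  by apply: bigcup_open => w _; exact: word_set_open.
have epsB0 : 0 < eps / B by rewrite divr_gt0.
have FF : Filter (\oo : set_system nat) by typeclasses eauto.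
have near_h := @near_lsc_mean_le R X nat \oo FF (fun k => orbit_average f x (n_ k)) mu h
  (fun k => orbit_average_positive f x (n_ k)) (portmanteau_open cptX cv) lsch h01
  (eps / B) epsB0.
have n_gt0 : \forall k \near \oo, (0 < n_ k)%N by apply: (n_oo [set n | (0 < n)%N]); exact: nbhs_infty_gt.
have bb := bounded_measurable_itinerary mf mA cP b.
have bmh : @bounded_measurable R _ (borel X) h.
  split; first exact: lsc_measurable.
  by exists 1 => y; have /andP[h0 h1] := h01 y; rewrite ger0_norm.
have bc1 := @bounded_measurable_cst R _ (borel X) 1.
have mean_h : 1 + - B^-1 * mean mu (fun y => b (itinerary f c m'.+1 y)) <= mean mu h.
  rewrite -(mean_cst mu 1) -meanZ// -(meanD mu bc1 (bounded_measurableZ _ bb)).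
  apply: le_mean => //; first exact: bounded_measurableD bc1 (bounded_measurableZ _ bb).
  move=> y; rewrite /h lerD2l !mulNr lerN2 ler_pM2l ?invr_gt0//.
  by have [_] := bestP y; apply.
apply: filterS2 near_h n_gt0 => k hk nk.
have bg : bounded_function g by exists B => y; rewrite ger0_norm ?b0// bB.
have [avgD avgZ _] := orbit_average_positive f x (n_ k).
have avg_h : orbit_average f x (n_ k) h = 1 + - B^-1 * orbit_average f x (n_ k) g.
  rewrite avgD; [|exact: bounded_function_cst|exact: bounded_functionZ].
  by rewrite avgZ// orbit_average1.
have := le_trans mean_h hk; rewrite avg_h -/g !mulNr => le_h.
have : B^-1 * orbit_average f x (n_ k) g <=
    B^-1 * (mean mu (fun y => b (itinerary f c m'.+1 y)) + eps).
  by rewrite mulrDr [B^-1 * eps]mulrC; move: le_h; lra.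
by rewrite ler_pM2l// invr_gt0.
Qed.

(** Cutting the orbit of [x] into cheapest words, from the best initial phase,
    gives strings on which the code length per unit of time is close to H_m / m,
    hence to the entropy, and the energy close to its mean.  The code is one of
    countably many. *)
Lemma coded_of_limit_measure x mu (U : seq (set X)) (C eps : R) :
  limit_measures f x mu -> finite_open_cover U ->
  (forall r (A : 'I_r -> set (borel X)), finite_partition A ->
     entropy_wrt f mu A + mean mu phi <= C) -> 0 < eps ->
  exists m' (a : {ffun {ffun 'I_m'.+1 -> 'I_(size U)} -> nat}),
    coded f phi (rational_code (R := R) a) (C + 6 * eps) x.
Proof.
move=> [inv [n_ [n_oo /(weak_star_orbit_average _ cptX) cv]]] covU entC eps0.
have mf := continuous_borel_fun contf.
have [A [c [partA cP cU]]] := cover_partition covU.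
have [mA _ _] := partA.
have [m' Hm] : exists m', join_entropy f mu A m'.+1 / m'.+1%:R <= entropy_wrt f mu A + eps.
  have /cvgrPdist_le/(_ _ eps0) cvH := entropy_wrt_cvg mf inv mA cP.
  have [[|m'] [Hn n0]] := filter_ex (filterI cvH (nbhs_infty_gt 0)); first by [].
  exists m'; move: Hn; rewrite distrC => /(le_trans (ler_norm _)).
  by rewrite lerBlDl.
have [a aP] := rational_code_approx (fun w => word_prob_ge0 f mu A w)
  (sum_word_prob mu mf mA cP m'.+1) eps0.
exists m', a; set b := rational_code a.
have b0 w : 0 <= b w := rational_code_ge0 a w.
have [best [best_set best_avg]] :=
  cheapest_word_average inv n_oo cv covU mA cP cU b0 eps0.
set H := join_entropy f mu A m'.+1 in Hm aP.
have meanb : mean mu (fun y => b (itinerary f c m'.+1 y)) <= H + eps.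
  by rewrite (mean_itinerary mu mf mA cP).
have [M phiM] := continuous_bounded cptX contphi.
have M0 : 0 <= M by apply: le_trans (phiM point).
have m0 : 0 < m'.+1%:R :> R by rewrite ltr0n.
move=> K.
(* Beyond the time [T] the errors due to the lengths of the prefix and of the
   incomplete last block, which are bounded, are negligible. *)
pose T := (2 * m'.+1%:R * M + m'.+1%:R * `|C + 6 * eps|) / (2 * eps).
have [n [avg_g avg_phi nK nT]] : exists n, [/\
    orbit_average f x n (b \o best) <= H + 2 * eps,
    orbit_average f x n phi <= mean mu phi + eps,
    (K.+1 * m'.+1 <= n)%N & T <= n%:R].
  have /cvgrPdist_le/(_ _ eps0) near_phi := cv phi contphi.
  have near_K : \forall k \near \oo, (K.+1 * m'.+1 <= n_ k)%N.
    by apply: (n_oo [set n | (K.+1 * m'.+1 <= n)%N]); exact: nbhs_infty_ge.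
  have near_T : \forall k \near \oo, T <= (n_ k)%:R.
    by apply: (n_oo [set n | T <= n%:R]); exact: nbhs_infty_ger.
  have [k [[gk phik] [Kk Tk]]] :=
    filter_ex (filterI (filterI best_avg near_phi) (filterI near_K near_T)).
  exists (n_ k); split=> //.
    by apply: (le_trans gk); move: meanb; lra.
  by move: phik; rewrite distrC => /(le_trans (ler_norm _)); rewrite lerBlDl.
have n0 : (0 < n)%N by apply: leq_trans nK.
have n0' : 0 < n%:R :> R by rewrite ltr0n.
pose kk := (n %/ m'.+1).-1.
have kkE : kk.+1 = (n %/ m'.+1)%N.
  by rewrite prednK// divn_gt0// (leq_trans _ nK)// leq_pmull.
have kkn : (kk.+1 * m'.+1 <= n)%N by rewrite kkE leq_trunc_div.
have nkk : (n < kk.+1 * m'.+1 + m'.+1)%N by rewrite kkE -mulSnr ltn_ceil.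
have Kkk : (K <= kk)%N by rewrite -ltnS kkE leq_divRL.
exists kk => //.
have [s sP] := exists_offset m' kk.+1 (fun t => b (best (iter t f x))).
exists ((s, itinerary f c m'.+1 x), [ffun i : 'I_kk.+1 => best (iter (s + i * m'.+1) f x)]).
split.
  apply: block_stringP => /= [t ts|i]; first by rewrite ffunE; exact: cU.
  by rewrite ffunE; exact: best_set.
rewrite size_block_string /=.
set N := (s + kk.+1 * m'.+1)%N.
set blocks := \sum_i b _.
have blocksE : blocks = \sum_(i < kk.+1) b (best (iter (s + i * m'.+1) f x)).
  by apply: eq_bigr => i _; rewrite ffunE.
have blocks_le : m'.+1%:R * blocks <= n%:R * (H + 2 * eps).
  rewrite blocksE; apply: (le_trans sP).
  apply: (@le_trans _ _ (birkhoff_sum f (b \o best) n x)).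
    rewrite /birkhoff_sum -!(big_mkord xpredT (fun t => b (best (iter t f x)))).
    by rewrite [leRHS](big_cat_nat (leq0n (kk.+1 * m'.+1)%N) kkn)/= lerDl sumr_ge0.
  by move: avg_g; rewrite /orbit_average ler_pdivrMl.
have Hm' : H <= m'.+1%:R * (entropy_wrt f mu A + eps).
  by move: Hm; rewrite ler_pdivrMr// mulrC.
have {}blocks_le : blocks <= n%:R * (entropy_wrt f mu A + 3 * eps).
  rewrite -(ler_pM2l m0); apply: (le_trans blocks_le).
  rewrite mulrCA ler_pM2l//; apply: (le_trans (lerD Hm' (lexx _))).
  have m1 : 1 <= m'.+1%:R :> R by rewrite ler1n.
  have := ler_wpM2r (ltW eps0) m1; lra.
have birk : birkhoff_sum f phi N x <= n%:R * (mean mu phi + eps) + 2 * m'.+1%:R * M.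
  apply: (le_trans (birkhoff_sum_perturb s x phiM kkn)); apply: lerD.
    by move: avg_phi; rewrite /orbit_average ler_pdivrMl.
  rewrite ler_wpM2r// -natrM ler_nat mul2n -addnn leq_add//; first exact: ltnW.
  by rewrite leq_subLR ltnW.
have dist : (n%:R - N%:R) * (C + 6 * eps) <= m'.+1%:R * `|C + 6 * eps|.
  apply: (le_trans (ler_norm _)); rewrite normrM ler_wpM2r// ler_norml.
  have h1 : n%:R <= N%:R + m'.+1%:R :> R.
    rewrite -natrD ler_nat /N ltnW// (leq_trans nkk)// leq_add2r leq_addl//.
  have h2 : N%:R <= n%:R + m'.+1%:R :> R.
    by rewrite -natrD ler_nat /N addnC leq_add// ltnW.
  by move: h1 h2; lra.
have hC := ler_wpM2l (ltW n0') (entC _ _ partA).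
have := nT; rewrite /T ler_pdivrMr ?mulr_gt0// => hT.
move: blocks_le birk dist hC hT; lra.
Qed.

(** For a fine cover, [Z] is a countable union of sets of coded points, so the
    pressure of the cover is at most [C] up to the oscillation of [phi]. *)
Lemma pp_pressure_le (Z : set X) (C : R) :
  (forall x, Z x -> exists mu, limit_measures f x mu /\ (free_energy f phi mu <= C%:E)%E) ->
  (pp_pressure f phi Z <= C%:E)%E.
Proof.
move=> VZ; have PF := mesh_to_0_proper cptX.
have osc_small (eps : R) : 0 < eps -> exists2 r, 0 < r & forall U : seq (set X),
    (mesh U < r%:E)%E -> oscillation_le phi U eps.
  move=> eps0; have [r r0 rP] := uniform_continuity cptX contphi eps0.
  exists r => // U Ur A AU x y Ax Ay; rewrite -lerBlDl.
  apply: (le_trans (ler_norm _)); rewrite ltW// distrC; apply: rP.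
  by rewrite ballEmdist/=; exact: mesh_mdist Ur AU Ax Ay.
apply: almost_monotone_lim_le => eps eps0.
  have [r r0 rP] := osc_small _ eps0; exists r => // U [covU Ur].
  have [e e0 eP] := lebesgue_number cptX covU; exists e => // V [_ Ve].
  apply: pp_pressure_cover_refine (rP U Ur) _ => B BV.
  have [->|/set0P[x Bx]] := eqVneq B set0.
    by have [A AU _] := eP point; exists A.
  have [A AU eA] := eP x; exists A => // y By; apply: eA.
  by rewrite ballEmdist/=; exact: mesh_mdist Ve BV Bx By.
(* One half of [eps] for the oscillation, the other half for the six errors of
   the coding. *)
have eps20 : 0 < eps / 2 by rewrite divr_gt0.
have eps120 : 0 < eps / 12 by rewrite divr_gt0.
have [r r0 rP] := osc_small _ eps20; exists r => // U [covU Ur].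
apply: pp_pressure_cover_le => alpha Calpha.
pose index : countType := {m' & {ffun {ffun 'I_m'.+1 -> 'I_(size U)} -> nat}}.
pose Zs (i : nat) : set X := if @unpickle index i is Some (existT m' a)
  then coded f phi (rational_code (R := R) a) (C + 6 * (eps / 12)) else set0.
apply: (@pp_limit_bigcup R X f phi Z Zs) => [i|x Zx].
  rewrite /Zs; case: unpickle => [[m' a]|].
    apply: pp_limit_coded (rP U Ur) _; first exact: rational_code_kraft.
    by move: Calpha; lra.
  apply/pp_limit_eq0 => N delta delta0; exists set0; split.
    by split=> //; exact: countable0.
  by rewrite esum_set0 lee_fin ltW.
have [mu [lmu muC]] := VZ x Zx.
have ent_le q (A : 'I_q -> set (borel X)) : finite_partition A ->
    entropy_wrt f mu A + mean mu phi <= C.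
  move=> partA; rewrite -lee_fin; apply: le_trans muC.
  rewrite /free_energy mean_EFin; last exact: continuous_bounded_measurable.
  rewrite EFinD leeD2r//; apply: ereal_sup_ubound.
  by exists q, A.
have [m' [a xa]] := coded_of_limit_measure lmu covU ent_le eps120.
exists (pickle (existT _ m' a : index)) => //.
by rewrite /Zs pickleK.
Qed.

End Covering.

Theorem theorem4p3 (R : realType) (X : pointedMetricType R)
    (f : X -> X) (phi : X -> R) (Z Y : set X)
    (cptX : compact [set: X]) (contf : continuous f) (contphi : continuous phi)
    (mZ : measurable (Z : set (borel X)))
    (defY : Y = closure (\bigcup_(k in [set: nat]) (iter k f @^-1` Z))) :
  (pp_pressure f phi Z <= star_pressure f phi Z)%E /\
  (forward_invariant f Y ->
     (star_pressure f phi Z <= classic_pressure f phi Y)%E).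
Proof.
have ZY : Z `<=` Y.
  by rewrite defY => x Zx; apply: subset_closure; exists 0%N.
split; last first.
  move=> fY; rewrite /star_pressure /classic_pressure.
  have [Z0|/eqP/eqP/set0P[z Zz]] := eqVneq Z set0.
    have -> : Y = set0; last by rewrite eqxx.
    rewrite defY Z0 (_ : \bigcup_(k in _) _ = set0) ?closure0//.
    by apply: bigcup0 => k _; rewrite preimage_set0.
  have /negPf -> : Y != set0 by apply/set0P; exists z; exact: ZY.
  apply: ge_ereal_sup => _ [mu [x Zx lmu] <-].
  apply: (limit_free_energy_le_classic cptX contf contphi lmu) => //.
    by rewrite defY; exact: closed_closure.
  exact: ZY.
have starP (C : R) : (star_pressure f phi Z <= C%:E)%E ->
    (pp_pressure f phi Z <= C%:E)%E.
  rewrite /star_pressure; have [->|Z0] := eqVneq Z set0.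
    by move=> _; apply: pp_pressure_le.
  move=> starC; apply: pp_pressure_le => // x Zx.
  have [mu lmu] := limit_measures_nonempty contf cptX x.
  exists mu; split=> //; apply: le_trans starC; apply: ereal_sup_ubound.
  by exists mu => //; exists x.
case starE : (star_pressure f phi Z) starP => [C| |] starP.
- exact: starP.
- exact: leey.
- case: (pp_pressure f phi Z) starP => [p| |] starP //.
    have := starP (p - 1) (leNye _); rewrite lee_fin => absurd_le.
    by exfalso; move: absurd_le; lra.
  by have := starP 0 (leNye _).
Qed.
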